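(* Let $d \geq 2$. For all integers $n \geq 1$ and $K \geq 1$, with probability one there exists a (random) integer $N_0 = N_0(n,K) \geq 0$ such that for all integers $N \geq N_0$, $$\mathcal{F}_n[N] \cap \mathbb{Z}_K = \mathcal{F}_n[N_0] \cap \mathbb{Z}_K,$$ meaning that all vertices and edges of $\mathcal{F}_n[N]$ and of $\mathcal{F}_n[N_0]$ inside the strip $\mathbb{Z}_K$ coincide.
   Context: Fix an integer $d\ge 2$ and let $\|x\|=\max_i |x_i|$. Let $\mathcal{H}=\{0\}\times\mathbb{Z}^{d-1}$ (the set of sources), $\mathcal{H}_M=\{0\}\times\{-M,\dots,M\}^{d-1}$ and $\mathbb{Z}_K=\mathbb{Z}\times\{-K,\dots,K\}^{d-1}$ for integers $M,K\ge 0$. Random inputs: $(\mathcal{N}_z)_{z\in\mathcal{H}}$ are i.i.d. Poisson point processes on $\mathbb{R}_+$ with intensity $1$; the successive points of $\mathcal{N}_z$ are $\tau_{z,1}<\tau_{z,2}<\cdots$. The $(S_{z,j})_{z\in\mathcal{H},j\ge1}$ are independent simple random walks on $\mathbb{Z}^d$, with $S_{z,j}(0)=z$, independent of the Poisson processes. The $j$-th particle of source $z$ is emitted at time $\tau_{z,j}$ and instantaneously follows $S_{z,j}$. Finite-volume aggregate and forest: given integers $n,M\ge0$, list the (a.s. finitely many) pairs $(z,j)$ with $z\in\mathcal{H}_M$ and $\tau_{z,j}\in[0,n]$ by increasing $\tau_{z,j}$ (a.s. distinct). Start with the empty aggregate $A=\emptyset$ and the empty graph $(V,E)=(\emptyset,\emptyset)$.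 For each pair $(z,j)$ in turn, let $k$ be the smallest index with $S_{z,j}(k)\notin A$ and $x=S_{z,j}(k)$. If $k=0$ (so $x=z$), replace $V$ by $V\cup\{x\}$ and leave $E$ unchanged (a new tree root). If $k\ge1$, let $x'=S_{z,j}(k-1)\in A$ and replace $V$ by $V\cup\{x\}$ and $E$ by $E\cup\{(x',x)\}$. In both cases replace $A$ by $A\cup\{x\}$. At the end, the aggregate is denoted $A^\dagger_n[M]$ and the graph is denoted $\mathcal{F}_n[M]$; its vertex set is $A^\dagger_n[M]$. All forests $\mathcal{F}_n[M]$, $M\ge 0$, are built on the same probability space from the same Poisson processes and walks. For a graph $\mathcal{F}$ on $\mathbb{Z}^d$, $\mathcal{F}\cap\mathbb{Z}_K$ consists of the vertices in $\mathbb{Z}_K$ and the edges with both endpoints in $\mathbb{Z}_K$. *)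

(* Defs.v *)
From HB Require Import structures.
From mathcomp Require Import all_boot all_order all_algebra finmap.
From mathcomp Require Import all_classical all_reals all_analysis measurable_realfun.

Set Implicit Arguments.
Unset Strict Implicit.
Unset Printing Implicit Defensive.

Import Order.TTheory GRing.Theory Num.Theory.
Local Open Scope classical_set_scope.
Local Open Scope ring_scope.

(* Coordinates of Z^d are numbered from 0. *)
Notation site d := 'rV[int]_d.

Definition is_source d (x : site d) : bool :=
  [forall i : 'I_d, (i == 0%N :> nat) ==> (x ord0 i == 0)].

Definition source d := {x : site d | is_source x}.

(* x lies in Z x {-K, ..., K}^(d-1) *)
Definition in_strip d (K : nat) (x : site d) : bool :=
  [forall i : 'I_d, (i != 0%N :> nat) ==> (`|x ord0 i| <= K%:Z)].

(* z lies in {0} x {-M, ..., M}^(d-1) *)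
Definition in_sources d (M : nat) (z : source d) : bool := in_strip M (val z).

Section randomness.
Context {R : realType} {disp : measure_display} {Omega : measurableType disp}.
Variable P : probability Omega R.

Definition mutually_independent (I : choiceType) (F : I -> set (set Omega)) :=
  forall (s : {fset I}) (E : I -> set Omega),
    (forall i, i \in s -> F i (E i)) ->
    P (\bigcap_(i in [set` s]) E i) = (\prod_(i <- s) P (E i))%E.

(* A (simple) point process is a random set of points. *)
Definition npoints (N : Omega -> set R) (B : set R) (w : Omega) : \bar R :=
  counting (N w `&` B).

Definition half_line : set R := `[0, +oo[.

(* The law is given by [poisson_prob] rather than [poisson_pmf], since
   [poisson_pmf 0 k] is 1 for every k while [poisson_prob 0] is the Dirac mass
   at 0; the second argument of [poisson_prob] is unused. *)
Definition poisson_process (lambda : R) (N : Omega -> set R) : Prop :=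
  [/\ forall w, N w `<=` half_line,
      forall B : set R, measurable B -> B `<=` half_line ->
        measurable_fun setT (npoints N B),
      forall B : set R, measurable B -> B `<=` half_line ->
        (lebesgue_measure B < +oo)%E -> forall k : nat,
        P [set w | npoints N B w = k%:R%:E] =
          poisson_prob (lambda * fine (lebesgue_measure B)) 0%N [set k]
    & forall (m : nat) (B : 'I_m -> set R),
        (forall i, measurable (B i)) -> (forall i, B i `<=` half_line) ->
        trivIset setT B ->
        mutually_independent
          (fun i => preimage_set_system setT (npoints N (B i)) measurable)].

(* The points of X, listed increasingly as t 0 < t 1 < ... *)
Definition successive_points (X : set R) (t : nat -> R) : Prop :=
  (forall j, t j < t j.+1) /\ range t = X.

Definition unit_step d (e : site d) : Prop :=
  exists i : 'I_d, e = delta_mx ord0 i \/ e = - delta_mx ord0 i.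

Definition increment d (S : nat -> Omega -> site d) (k : nat) (w : Omega) :
    site d :=
  S k.+1 w - S k w.

Definition simple_random_walk d (x : site d) (S : nat -> Omega -> site d) :
    Prop :=
  [/\ forall k y, measurable [set w | S k w = y],
      forall w, S 0%N w = x,
      forall k e, unit_step e ->
        P [set w | increment S k w = e] = ((2 * d)%N%:R^-1)%:E
    & mutually_independent
        (fun k => preimage_set_system setT (increment S k) setT)].

Definition sigma_process (N : Omega -> set R) : set (set Omega) :=
  <<s \bigcup_(B in [set B : set R | measurable B /\ B `<=` half_line])
        preimage_set_system setT (npoints N B) measurable >>.

Definition sigma_walk d (S : nat -> Omega -> site d) : set (set Omega) :=
  <<s \bigcup_k preimage_set_system setT (S k) setT >>.

Definition sigma_input d (N : source d -> Omega -> set R)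
    (S : source d -> nat -> nat -> Omega -> site d)
    (i : source d + source d * nat) : set (set Omega) :=
  match i with
  | inl z => sigma_process (N z)
  | inr (z, j) => sigma_walk (S z j)
  end.

(* Walks and emission times are numbered from j = 0: [S z j] and [tau z j] are
   the walk and the emission time of particle j + 1 of source z.  Mutual
   independence of the whole family says at once that the processes are
   independent, that the walks are independent, and that the walks are
   independent of the processes. *)
Definition random_inputs d (N : source d -> Omega -> set R)
    (tau : source d -> nat -> Omega -> R)
    (S : source d -> nat -> nat -> Omega -> site d) : Prop :=
  [/\ forall z, poisson_process 1 (N z),
      forall z, {ae P, forall w, successive_points (N z w) (tau z ^~ w)},
      forall z j, simple_random_walk (val z) (S z j)
    & mutually_independent (sigma_input N S)].

End randomness.

Record graph d := Graph {
  vertices : {fset site d};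
  edges : {fset site d * site d} }.

Definition restrict_strip d (K : nat) (G : graph d) : graph d :=
  Graph [fset x in vertices G | in_strip K x]%fset
        [fset e in edges G | in_strip K e.1 && in_strip K e.2]%fset.

Section forest.
Context {R : realType} {d : nat}.

(* The smallest k with s k outside A; None if the path s never leaves A. *)
Definition exit_index (A : {fset site d}) (s : nat -> site d) : option nat :=
  if pselect (exists k, s k \notin A) is left h then Some (ex_minn h) else None.

(* One particle with trajectory s.  A particle that never leaves the aggregate
   (a null event) is discarded. *)
Definition add_particle (AG : {fset site d} * graph d) (s : nat -> site d) :
    {fset site d} * graph d :=
  let: (A, Graph V E) := AG in
  match exit_index A s with
  | None => AG
  | Some 0%N => ((s 0%N |` A)%fset, Graph (s 0%N |` V)%fset E)
  | Some k.+1 =>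
      ((s k.+1 |` A)%fset,
       Graph (s k.+1 |` V)%fset ((s k, s k.+1) |` E)%fset)
  end.

(* Sorting is strict, so this is the list of emissions from the sources of H_M
   during [0, n] by increasing time whenever they are finitely many and have
   distinct times; otherwise (a null event) it is the empty list. *)
Definition emissions (tau : source d -> nat -> R) (n M : nat) :
    seq (source d * nat) :=
  xget [::] [set s : seq (source d * nat) |
    sorted (fun p q => tau p.1 p.2 < tau q.1 q.2) s /\
    forall p, (p \in s) =
      in_sources M p.1 && (0 <= tau p.1 p.2 <= n%:R)].

(* The pair of the aggregate A and of the forest built together with it. *)
Definition aggregate_forest (tau : source d -> nat -> R)
    (S : source d -> nat -> nat -> site d) (n M : nat) :
    {fset site d} * graph d :=
  foldl (fun AG p => add_particle AG (S p.1 p.2))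
    (fset0, Graph fset0 fset0) (emissions tau n M).

Definition forest tau S n M : graph d := (aggregate_forest tau S n M).2.

End forest.

(* Main.v *)
(** Adding the emissions of the sources of H_(M+1) \ H_M enlarges the aggregate
    at every time, and the excess sites behave like second-class particles: a
    walk that leaves the small aggregate at an excess site wakes it up and
    carries it on until it leaves the large aggregate.  The two forests agree in
    the strip unless some excess site ever lies in it.

    Heights.  By translation, for a fixed sequence of steps at most one source
    sends its walk to a given site as the first visit to the level of that
    site.  Hence the sum of 2^|x_0| over the aggregate, plus |H_(M+1)|, grows by
    a factor at most 1 + dt on average during dt, so that the aggregate built from H_(M+1) leaves
    {|x_0| < H} with probability at most |H_(M+1)| e^n 2^(-H).

    Excess.  On {|x_0| < H} the function (2 H^2 - x_0^2) q^(|x_1| + ... + |x_(d-1)|),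
    q = 1 - 1/(2dH), is superharmonic, so its sum over the excess sites, stopped
    when the excess enters the strip, increases on average by at most the
    contribution of the new particles, which is of order q^M.

    With H close to sqrt M both bounds are summable in M, and Borel-Cantelli
    applies.  To compute with laws, [0, n] is cut into B bins of equal length;
    outside an event of probability O(1/B) each bin contains at most one
    emission, and for walks stopped after T steps the law of the resulting
    finite history is an explicit product. *)
Require Import Defs.
From mathcomp Require Import all_boot all_order all_algebra finmap.
From mathcomp Require Import all_classical all_reals all_analysis measurable_realfun.
From mathcomp Require Import zify ring lra.

Import Order.TTheory GRing.Theory Num.Theory.
Local Open Scope classical_set_scope.
Local Open Scope ring_scope.
Set Implicit Arguments.
Unset Strict Implicit.
Unset Printing Implicit Defensive.

(** * Exit sites and excess *)

Section exit.
Variable d : nat.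
Implicit Types (A : {fset site d}) (s : nat -> site d).

Definition exit_site A s : option (site d) := omap s (exit_index A s).

Lemma exit_index_SomeP A s k :
  exit_index A s = Some k <-> s k \notin A /\ forall i, (i < k)%N -> s i \in A.
Proof.
rewrite /exit_index; case: pselect => [h|h]; split.
- case=> <-; case: ex_minnP => m mA min; split=> // i im.
  by apply: contraTT im => /min; rewrite -leqNgt.
- case=> kA kmin; case: ex_minnP => m mA min; congr Some.
  apply/eqP; rewrite eqn_leq min //= leqNgt; apply/negP => /kmin.
  by rewrite (negbTE mA).
- by [].
- by case=> kA _; case: h; exists k.
Qed.

Lemma exit_index_NoneP A s : exit_index A s = None <-> forall k, s k \in A.
Proof.
rewrite /exit_index; case: pselect => [h|h]; split => //.
- by move=> sA; exfalso; case: h => k; rewrite sA.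
- by move=> _ k; apply/negPn/negP => kA; apply: h; exists k.
Qed.

Lemma exit_site_notin A s x : exit_site A s = Some x -> x \notin A.
Proof.
rewrite /exit_site; case E: exit_index => [k|] //= [<-].
by case/exit_index_SomeP: E.
Qed.

Lemma exit_siteE A s :
  exit_site A s = if s 0%N \in A then exit_site A (fun k => s k.+1) else Some (s 0%N).
Proof.
rewrite /exit_site; case: ifPn => s0.
- case E: (exit_index A (fun k => s k.+1)) => [k|] /=.
    have /exit_index_SomeP [kA kmin] := E.
    suff -> : exit_index A s = Some k.+1 by [].
    by apply/exit_index_SomeP; split=> // -[|i] //; rewrite ltnS => /kmin.
  have /exit_index_NoneP kA := E.
  suff -> : exit_index A s = None by [].
  by apply/exit_index_NoneP => -[|k].
- suff -> : exit_index A s = Some 0%N by [].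
  by apply/exit_index_SomeP.
Qed.

(** Until it leaves A the walk is also inside A', so it leaves A' no earlier, and both exits happen
    at once when the exit site of A lies outside A'. A walk that never leaves A never leaves A'. *)
Lemma exit_site_sub A A' s : (A `<=` A')%fset ->
  match exit_site A s with
  | None => exit_site A' s = None
  | Some x => x \notin A' -> exit_index A' s = exit_index A s
  end.
Proof.
move=> /fsubsetP AA'; rewrite /exit_site; case E: (exit_index A s) => [k|] /=.
  have /exit_index_SomeP [kA kmin] := E => kA'.
  by apply/exit_index_SomeP; split=> // i /kmin /AA'.
have /exit_index_NoneP kA := E.
suff -> : exit_index A' s = None by [].
by apply/exit_index_NoneP => k; apply/AA'/kA.
Qed.

Definition add_site A (o : option (site d)) : {fset site d} :=
  if o is Some x then (x |` A)%fset else A.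

Lemma add_particle_aggregate AG s :
  (add_particle AG s).1 = add_site AG.1 (exit_site AG.1 s).
Proof.
by case: AG => A [V E]; rewrite /add_particle /exit_site /=; case: exit_index => [[|k]|].
Qed.

(** An exit site of A that lies in A' keeps A inside A'; an exit site outside A' is gained by both.
    This keeps the coupled aggregates nested. *)
Lemma add_site_sub A A' s : (A `<=` A')%fset ->
  (add_site A (exit_site A s) `<=` add_site A' (exit_site A' s))%fset.
Proof.
move=> AA'; have := exit_site_sub s AA'.
case E: (exit_site A s) => [x|] /=; last by move=> ->.
case: (boolP (x \in A')) => [xA' _|xA' /(_ isT)].
  have {AA'}: (x |` A `<=` A')%fset by rewrite fsubUset fsub1set xA'.
  move=> h; apply: (fsubset_trans h); rewrite /add_site.
  by case: exit_site => // y; apply: fsubsetUr.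
rewrite /exit_site => ->; move: E; rewrite /exit_site => -> /=.
by apply: fsetUS.
Qed.

End exit.

Section excess.
Variables (R : numDomainType) (d : nat) (phi : site d -> R).
Implicit Types (A : {fset site d}).

Definition excess A A' : R := \sum_(x <- (A' `\` A)%fset) phi x.

(* A site that enters the smaller aggregate leaves the excess, and the larger
   aggregate then puts it back where the same walk leaves the larger aggregate. *)
Lemma excess_add A A' s : (A `<=` A')%fset ->
  excess (add_site A (exit_site A s)) (add_site A' (exit_site A' s)) =
  excess A A' - oapp phi 0 (exit_site A s) + oapp phi 0 (exit_site A' s).
Proof.
move=> AA'; have sub := fsubsetP AA'; have := exit_site_sub s AA'.
case E: (exit_site A s) => [x|] /=; last by move=> -> /=; rewrite subr0 addr0.
have xA := exit_site_notin E.
case: (boolP (x \in A')) => [xA' _|xA' /(_ isT)].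
  have exx : excess (x |` A)%fset A' = excess A A' - phi x.
    rewrite /excess [in RHS](big_fsetD1 x) /=; last by rewrite inE xA xA'.
    by rewrite addrAC subrr add0r; apply: eq_fbigl => y; rewrite !inE; case: eqP.
  case E': (exit_site A' s) => [y|] /=; last by rewrite addr0.
  have yA' := exit_site_notin E'.
  rewrite -exx /excess (big_fsetD1 y) /=; last first.
    rewrite !inE eqxx /= andbT negb_or; apply/andP; split.
      by apply: contraNneq yA' => ->.
    by apply: contraNN yA' => /sub.
  rewrite addrC; congr (_ + _); apply: eq_fbigl => z; rewrite !inE.
  case: (z =P y) => [->|] //=; rewrite (negbTE yA') andbF //.
rewrite /exit_site => E'; have -> : omap s (exit_index A' s) = Some x.
  by rewrite E' -/(exit_site A s) E.
rewrite /= subrK /excess; apply: eq_fbigl => z; rewrite !inE.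
by case: (z =P x) => [->|] //=; rewrite (negbTE xA') andbF.
Qed.

(** This is the case of a particle from an extra source: it acts on the larger aggregate only. *)
Lemma excess_add_extra A A' s : (A `<=` A')%fset ->
  excess A (add_site A' (exit_site A' s)) =
  excess A A' + oapp phi 0 (exit_site A' s).
Proof.
move=> AA'; have sub := fsubsetP AA'.
case E': (exit_site A' s) => [y|] /=; last by rewrite addr0.
have yA' := exit_site_notin E'.
rewrite /excess (big_fsetD1 y) /=; last first.
  by rewrite !inE eqxx /= andbT; apply: contraNN yA' => /sub.
rewrite addrC; congr (_ + _); apply: eq_fbigl => z; rewrite !inE.
by case: (z =P y) => [->|] //=; rewrite (negbTE yA') andbF.
Qed.

End excess.

(** * Finite step sequences and mean values at exit sites *)

Section trajectories.
Variable d : nat.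
Local Notation step := ('I_d * bool)%type.
Implicit Types (x : site d) (om : seq step).

Definition step_vector (e : step) : site d :=
  if e.2 then - delta_mx ord0 e.1 else delta_mx ord0 e.1.

(** Since [take k om] is all of [om] for large k, the path rests at its end point: it is a walk
    stopped after [size om] steps. *)
Definition traj x om k : site d := x + \sum_(e <- take k om) step_vector e.

Lemma traj0 x om : traj x om 0 = x.
Proof. by rewrite /traj take0 big_nil addr0. Qed.

Lemma traj_nil x k : traj x [::] k = x.
Proof. by rewrite /traj big_nil addr0. Qed.

Lemma traj_cons x e om k : traj x (e :: om) k.+1 = traj (x + step_vector e) om k.
Proof. by rewrite /traj /= big_cons addrA. Qed.

Lemma traj_shift x om k : traj x om k = x + traj 0 om k.
Proof. by rewrite /traj add0r. Qed.

Lemma exit_site_nil A x : x \in A -> exit_site A (traj x [::]) = None.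
Proof.
move=> xA; rewrite /exit_site.
suff -> : exit_index A (traj x [::]) = None by [].
by apply/exit_index_NoneP => k; rewrite traj_nil.
Qed.

Lemma exit_site_cons A x e om : exit_site A (traj x (e :: om)) =
  if x \in A then exit_site A (traj (x + step_vector e) om) else Some x.
Proof.
rewrite exit_siteE traj0; case: ifP => // xA.
by congr exit_site; apply/funext => k; rewrite traj_cons.
Qed.

Fixpoint paths (T : nat) : seq (seq step) :=
  if T is T'.+1 then [seq e :: om | e <- index_enum _, om <- paths T']
  else [:: [::]].

Lemma size_paths T : size (paths T) = ((2 * d) ^ T)%N.
Proof.
elim: T => //= T IH; rewrite size_allpairs IH expnS; congr (_ * _)%N.
by rewrite -sum1_size sum1_card card_prod card_ord card_bool mulnC.
Qed.

Lemma mem_paths T om : (om \in paths T) = (size om == T).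
Proof.
elim: T om => [|T IH] [|e om] //=.
- by apply/negbTE/negP => /allpairsP[[? ?] /= [_ _]].
- rewrite eqSS -IH; apply/allpairsP/idP => [[[e' om'] /= [_ h [_ ->]]] //|h].
  by exists (e, om); rewrite /= mem_index_enum.
Qed.

Lemma step_vector_inj : injective step_vector.
Proof.
move=> [i b] [i' b'] /matrixP /(_ ord0 i); rewrite /step_vector /=.
by case: b; case: b'; rewrite !mxE !eqxx /=; case: (i =P i') => [->|].
Qed.

Lemma traj_inj om om' x : size om = size om' ->
  (forall k, (k <= size om)%N -> traj x om k = traj x om' k) -> om = om'.
Proof.
elim: om om' x => [|e om IH] [|e' om'] x //= [sz] h.
have e_e' : e = e'.
  by have := h 1%N isT; rewrite !traj_cons !traj0 => /addrI /step_vector_inj.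
rewrite -e_e' in h *; congr cons; apply: (IH _ (x + step_vector e)) => // k ks.
by rewrite -!traj_cons h.
Qed.

Lemma traj_step om x k : (k < size om)%N ->
  exists e, traj x om k.+1 = traj x om k + step_vector e.
Proof.
elim: om x k => // e om IH x [|k] /=; last by rewrite !traj_cons => /IH.
by rewrite traj_cons !traj0; exists e.
Qed.

Lemma traj_next x om k :
  traj x om k.+1 = traj x om k \/
  exists e, traj x om k.+1 = traj x om k + step_vector e.
Proof.
case: (ltnP k (size om)) => ks; first by right; apply: traj_step.
by left; rewrite /traj !take_oversize // ltnW.
Qed.

Lemma big_paths (R : nmodType) (T : nat) (f : seq step -> R) :
  \sum_(om <- paths T.+1) f om = \sum_e \sum_(om <- paths T) f (e :: om).
Proof. by rewrite [paths T.+1]/= big_allpairs_dep. Qed.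

Section superharmonic.
Variables (R : numDomainType) (phi : site d -> R) (C : pred (site d)).
Hypothesis phi_super :
  forall x, C x -> \sum_(e : step) phi (x + step_vector e) <= (2 * d)%:R * phi x.
Hypothesis phi_ge0 : forall x, C x -> 0 <= phi x.

(** Up to the factor (2d)^T, the mean of [phi] at the site where a walk of T steps from x leaves A;
    a walk that does not leave in time counts 0. *)
Let exit_sum T A x := \sum_(om <- paths T) oapp phi 0 (exit_site A (traj x om)).

Let exit_sum_out T A x : x \notin A -> exit_sum T A x = ((2 * d) ^ T)%:R * phi x.
Proof.
move=> xA; rewrite /exit_sum (eq_bigr (fun=> phi x)) => [|om _].
  by rewrite big_const_seq count_predT size_paths iter_addr_0 mulr_natl.
by rewrite exit_siteE traj0 (negbTE xA).
Qed.

Let exit_sum_in T A x : x \in A ->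
  exit_sum T.+1 A x = \sum_e exit_sum T A (x + step_vector e).
Proof.
move=> xA; rewrite /exit_sum big_paths; apply: eq_bigr => e _.
by apply: eq_bigr => om _; rewrite exit_site_cons xA.
Qed.

Let exit_sum0 A x : x \in A -> exit_sum 0 A x = 0.
Proof. by move=> xA; rewrite /exit_sum /= big_seq1 exit_site_nil. Qed.

(** Optional stopping for a superharmonic function, by induction on the number of steps. Walks still
    inside A at time T count 0, which is at most [phi] there. *)
Lemma exit_sum_le T (A : {fset site d}) x : {subset A <= C} ->
  exit_sum T A x <= ((2 * d) ^ T)%:R * phi x.
Proof.
move=> AC; elim: T x => [|T IH] x; case: (boolP (x \in A)) => xA.
- by rewrite exit_sum0 // mul1r; apply: phi_ge0; exact: AC.
- by rewrite exit_sum_out.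
- rewrite exit_sum_in //; apply: (le_trans (ler_sum _ (fun e _ => IH _))).
  rewrite -mulr_sumr expnSr natrM -mulrA ler_wpM2l ?ler0n //.
  exact: phi_super (AC _ xA).
- by rewrite exit_sum_out.
Qed.

(** The larger set is left later, and a superharmonic function decreases in the mean meanwhile. Both
    sums follow the same recursion inside A; outside A the right side is exactly (2d)^T [phi x],
    which bounds the left side by optional stopping. *)
Lemma exit_sum_anti T (A A' : {fset site d}) x :
    (A `<=` A')%fset -> {subset A' <= C} -> exit_sum T A' x <= exit_sum T A x.
Proof.
move=> /fsubsetP AA' A'C; elim: T x => [|T IH] x; case: (boolP (x \in A)) => xA.
- by rewrite !exit_sum0 // AA'.
- by rewrite (exit_sum_out _ xA) exit_sum_le.
- by rewrite !exit_sum_in ?AA' //; apply: ler_sum.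
- by rewrite (exit_sum_out _ xA) exit_sum_le.
Qed.

End superharmonic.
End trajectories.

(** * A superharmonic function and heights *)

Lemma ler_sum_sub_seq (R : numDomainType) (I : eqType) (s t : seq I) (f : I -> R) :
  (forall i, 0 <= f i) -> uniq s -> {subset s <= t} ->
  \sum_(i <- s) f i <= \sum_(i <- t) f i.
Proof.
move=> f0; elim: s t => [|x s IH] t /=; first by rewrite big_nil sumr_ge0.
case/andP=> xs us st; have xt : x \in t by apply: st; rewrite inE eqxx.
rewrite big_cons (perm_big _ (perm_to_rem xt)) big_cons lerD2l; apply: IH => // y ys.
have := st y; rewrite inE ys orbT => /(_ isT) yt.
have yx : y != x by apply: contraNneq xs => <-.
by move: yt; rewrite (perm_mem (perm_to_rem xt)) inE (negbTE yx).
Qed.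

Lemma sum_le1_unique (R : numDomainType) (I : eqType) (s : seq I) (p : pred I) :
  uniq s -> {in s &, forall i j, p i -> p j -> i = j} ->
  \sum_(i <- s) (p i)%:R <= 1 :> R.
Proof.
elim: s => [|x s IH] /=; first by rewrite big_nil ler01.
case/andP=> xs us pu; rewrite big_cons.
have IH' : \sum_(i <- s) (p i)%:R <= 1 :> R.
  by apply: IH => // i j si sj; apply: pu; rewrite inE ?si ?sj orbT.
case: (boolP (p x)) => px; last by rewrite add0r.
rewrite big_seq big1 ?addr0 // => i si; case: (boolP (p i)) => // pi.
by move: xs; rewrite (pu x i) ?inE ?eqxx ?si ?orbT.
Qed.

Section potential.
Variables (R : realFieldType) (d : nat).
Local Notation step := ('I_d.+1 * bool)%type.
Implicit Types (x y : site d.+1).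

Definition height x : nat := `|x ord0 ord0|%N.
Definition lateral x : nat := \sum_(i | i != ord0) `|x ord0 i|%N.

(* The rate is chosen so that the gain of [tent] under lateral steps is at most
   its loss under vertical ones. *)
Definition decay (H : nat) : R := 1 - ((2 * d.+1 * H)%:R)^-1.

(** The coefficient 2 of H^2 keeps the parabola between H^2 and 2 H^2 at heights up to H; its
    concavity pays for the convexity of the lateral factor. *)
Definition tent (H : nat) x : R :=
  (2 * H%:R ^+ 2 - (height x)%:R ^+ 2) * decay H ^+ lateral x.

Section decay.
Variables (H : nat).
Hypothesis H_gt0 : (0 < H)%N.

Let eps : R := ((2 * d.+1 * H)%:R)^-1.

Let eps_gt0 : 0 < eps. Proof. by rewrite invr_gt0 ltr0n !muln_gt0 H_gt0. Qed.

Let eps_le : eps <= 2^-1.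
Proof. by rewrite lef_pV2 ?posrE ?ltr0n ?ler_nat; lia. Qed.

Lemma decay_gt0 : 0 < decay H.
Proof. by rewrite /decay -/eps; have := eps_le; lra. Qed.

Lemma decay_le1 : decay H <= 1.
Proof. by rewrite /decay -/eps; have := eps_gt0; lra. Qed.

(** Write q for the decay. Away from 0 the claim reduces to q^2 + 1 = 2q + eps^2 <= (2 + 2 eps^2) q,
    which holds because q >= 1/2; at 0 it is 2q <= 2 + 2 eps^2. *)
Lemma decay_lateral_step (a : int) :
  decay H ^+ absz (a + 1) + decay H ^+ absz (a - 1) <= (2 + 2 * eps ^+ 2) * decay H ^+ `|a|%N.
Proof.
have q0 := decay_gt0; have e0 := eps_gt0; have e2 := eps_le.
have key (n : nat) : decay H ^+ n.+2 + decay H ^+ n <= (2 + 2 * eps ^+ 2) * decay H ^+ n.+1.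
  have -> : decay H ^+ n.+2 + decay H ^+ n = (decay H ^+ 2 + 1) * decay H ^+ n.
    by rewrite !exprS; ring.
  have -> : (2 + 2 * eps ^+ 2) * decay H ^+ n.+1
    = ((2 + 2 * eps ^+ 2) * decay H) * decay H ^+ n by rewrite (exprS _ n) mulrA.
  rewrite ler_wpM2r ?exprn_ge0 ?(ltW q0) // /decay -/eps.
  have : 0 <= eps ^+ 2 * (1 - 2 * eps) by rewrite mulr_ge0 ?exprn_ge0 ?subr_ge0; lra.
  nra.
case: a => [[|n]|n].
- rewrite add0r sub0r absz1 abszN absz1 absz0 !expr1 expr0 mulr1.
  by rewrite /decay -/eps; have := exprn_ge0 2 (ltW e0); lra.
- have -> : absz (Posz n.+1 + 1) = n.+2 by lia.
  have -> : absz (Posz n.+1 - 1) = n by lia.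
  exact: key.
- have -> : absz (Negz n + 1) = n by lia.
  have -> : absz (Negz n - 1) = n.+2 by lia.
  by rewrite addrC; exact: key.
Qed.

Lemma tent_ge0 x : (height x <= H)%N -> 0 <= tent H x.
Proof.
move=> xH; rewrite mulr_ge0 ?exprn_ge0 ?(ltW decay_gt0) // subr_ge0 -natrX -natrX.
by rewrite -natrM ler_nat; nia.
Qed.

(** With psi the parabola and Q the lateral factor, the two vertical neighbours sum to (2 psi - 2) Q
    and each of the d lateral pairs to at most (2 + 2 eps^2) psi Q. *)
Lemma tent_superharmonic x : (height x < H)%N ->
  \sum_(e : step) tent H (x + step_vector e) <= (2 * d.+1)%:R * tent H x.
Proof.
move=> xH; pose psi : R := 2 * H%:R ^+ 2 - (height x)%:R ^+ 2.
have psi0 : 0 <= psi.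
  by rewrite subr_ge0 -!natrX -natrM ler_nat; nia.
have psiH : psi <= 2 * H%:R ^+ 2 by rewrite gerBl exprn_ge0 ?ler0n.
pose Q := decay H ^+ lateral x; have q0 := decay_gt0.
have Q0 : 0 <= Q by rewrite exprn_ge0 ?(ltW q0).
have tentE : tent H x = psi * Q by [].
have coordE (b : bool) (i j : 'I_d.+1) : (x + step_vector (i, b)) ord0 j =
    x ord0 j + (if b then -1 else 1) * (j == i)%:R.
  rewrite mxE /step_vector /=; case: b; rewrite !mxE eqxx /=; lia.
have -> : \sum_(e : step) tent H (x + step_vector e) =
    \sum_i \sum_b tent H (x + step_vector (i, b)).
  by rewrite pair_bigA /=; apply: eq_bigr => -[].
rewrite (bigD1 ord0) //= big_bool /=.
have vert : tent H (x + step_vector (ord0, true)) + tent H (x + step_vector (ord0, false)) =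
    (2 * psi - 2) * Q.
  rewrite /tent.
  have latE b : lateral (x + step_vector (ord0, b)) = lateral x.
    by apply: eq_bigr => i /negbTE i0; rewrite coordE i0 mulr0 addr0.
  rewrite !latE -/Q -mulrDl; congr (_ * _); rewrite /psi /height !coordE eqxx mulr1 mulr1.
  rewrite !natr_absz !intr_norm !real_normK ?num_real // !rmorphD /= rmorphN1 rmorph1; ring.
have lat i : i != ord0 ->
    tent H (x + step_vector (i, true)) + tent H (x + step_vector (i, false)) <=
    (2 + 2 * eps ^+ 2) * psi * Q.
  move=> i0; rewrite /tent.
  have hE b : height (x + step_vector (i, b)) = height x.
    by rewrite /height coordE eq_sym (negbTE i0) mulr0 addr0.
  pose r := (\sum_(j | (j != ord0) && (j != i)) `|x ord0 j|)%N.
  have lE b : lateral (x + step_vector (i, b)) =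
      (absz (x ord0 i + if b then -1 else 1)%R + r)%N.
    rewrite /lateral (bigD1 i) //= coordE eqxx mulr1; congr addn.
    by apply: eq_bigr => j /andP[_ /negbTE ji]; rewrite coordE ji mulr0 addr0.
  rewrite !hE -/psi !lE /Q /lateral (bigD1 i) //= -/r !exprD -mulrDr -mulrDl.
  rewrite [leRHS](_ : _ =
    psi * (((2 + 2 * eps ^+ 2) * decay H ^+ `|x ord0 i|) * decay H ^+ r)); last by ring.
  rewrite ler_wpM2l // ler_wpM2r ?exprn_ge0 ?(ltW q0) // addrC.
  exact: decay_lateral_step.
rewrite vert; under eq_bigr do rewrite big_bool /=.
apply: (@le_trans _ _ ((2 * psi - 2) * Q +
    \sum_(i : 'I_d.+1 | i != ord0) (2 + 2 * eps ^+ 2) * psi * Q)).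
  by rewrite lerD2l; apply: ler_sum => i; apply: lat.
rewrite sumr_const.
have -> : #|[pred i : 'I_d.+1 | i != ord0]| = d.
  by rewrite -[RHS]/(d.+1.-1) -[in RHS](card_ord d.+1) -(cardC1 (ord0 : 'I_d.+1)); apply: eq_card.
rewrite tentE -[_ *+ d]mulr_natr.
have -> : (2 * psi - 2) * Q + (2 + 2 * eps ^+ 2) * psi * Q * d%:R =
  (2 * d.+1)%:R * (psi * Q) + (psi * (2 * eps ^+ 2 * d%:R) - 2) * Q.
  by rewrite natrM -natr1; ring.
rewrite gerDl mulr_le0_ge0 // subr_le0.
(* Since psi <= 2 H^2 and 2 eps H = 1/(d+1), the lateral gain is at most d/(d+1)^2 <= 1, below the
   vertical loss 2. *)
apply: (@le_trans _ _ ((2 * H%:R ^+ 2) * (2 * eps ^+ 2 * d%:R))).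
  by rewrite ler_wpM2r // !mulr_ge0 ?exprn_ge0 ?ler0n // ltW.
have He : eps * (2 * d.+1%:R * H%:R) = 1.
  rewrite /eps !natrM mulVf // !mulf_neq0 ?pnatr_eq0 //; lia.
have : (eps * (2 * d.+1%:R * H%:R)) ^+ 2 = 1 by rewrite He expr1n.
have -> : 2 * H%:R ^+ 2 * (2 * eps ^+ 2 * d%:R) = (2 * eps * H%:R) ^+ 2 * d%:R by ring.
have -> : (eps * (2 * d.+1%:R * H%:R)) ^+ 2 = (2 * eps * H%:R) ^+ 2 * d.+1%:R ^+ 2 by ring.
set u := (2 * eps * H%:R) ^+ 2 => hu.
have u0 : 0 <= u by rewrite /u !exprn_ge0 // !mulr_ge0 ?ler0n // ltW.
apply: (@le_trans _ _ (u * d.+1%:R ^+ 2)); last by rewrite hu ler1n.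
by rewrite ler_wpM2l // -natrX ler_nat; nia.
Qed.

Lemma tent_lower x K : (height x < H)%N -> in_strip K x ->
  H%:R ^+ 2 * decay H ^+ (d * K) <= tent H x.
Proof.
move=> xH xK; have q0 := decay_gt0; apply: ler_pM.
- by rewrite exprn_ge0 ?ler0n.
- by rewrite exprn_ge0 ?ltW.
- rewrite lerBrDr -!natrX -natrM -natrD ler_nat; nia.
- apply: ler_wiXn2l; rewrite ?(ltW q0) ?decay_le1 //.
  apply: (@leq_trans (\sum_(i < d.+1 | i != ord0) K)).
    apply: leq_sum => i i0; move/forallP: xK => /(_ i) /implyP.
    by rewrite -val_eqE in i0; move=> /(_ i0); lia.
  rewrite sum_nat_const leq_mul2r; apply/orP; right.
  by rewrite (@eq_card _ _ (predC1 ord0)) // cardC1 card_ord.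
Qed.

Lemma tent_upper (z : source d.+1) M : ~~ in_sources M z ->
  tent H (val z) <= 2 * H%:R ^+ 2 * decay H ^+ M.+1.
Proof.
have q0 := decay_gt0; rewrite /in_sources /in_strip negb_forall => /existsP[i].
rewrite negb_imply => /andP[i0 zi].
apply: ler_pM; rewrite ?exprn_ge0 ?(ltW q0) //.
- have -> : height (val z) = 0%N.
    by move/forallP: (valP z) => /(_ ord0) /implyP /(_ isT) /eqP zz; rewrite /height zz.
  by rewrite expr0n /= subr0 mulr_ge0 ?exprn_ge0 ?ler0n.
- by rewrite gerBl exprn_ge0 ?ler0n.
- apply: ler_wiXn2l; rewrite ?(ltW q0) ?decay_le1 //.
  rewrite /lateral (bigD1 i) -?val_eqE //= (leq_trans _ (leq_addr _ _)) //.
  by move: zi; rewrite -ltNge -abszE ltz_nat.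
Qed.

End decay.

End potential.

(** * Exponential weight of heights *)

Section height_weight.
Variables (R : realFieldType) (d : nat).
Local Notation step := ('I_d.+1 * bool)%type.
Implicit Types (A : {fset site d.+1}) (om : seq step) (z : source d.+1).

Definition height_weight A : R := \sum_(x <- A) 2 ^+ height x.

Lemma height_weight_ge0 A : 0 <= height_weight A.
Proof. by apply: sumr_ge0 => x _; rewrite exprn_ge0. Qed.

Lemma height_weight_ge A x : x \in A -> 2 ^+ height x <= height_weight A.
Proof.
move=> xA; rewrite /height_weight (big_fsetD1 x) //= lerDl.
exact: height_weight_ge0.
Qed.

Lemma height_weight_add A x : x \notin A ->
  height_weight (x |` A)%fset = 2 ^+ height x + height_weight A.
Proof. by move=> xA; rewrite /height_weight big_fsetU1. Qed.

(** The walk from z makes its first visit to the hyperplane through y, orthogonal to the first axis,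
    at y itself. *)
Let hits_level z om (y : site d.+1) : bool :=
  `[< exists2 i, traj (val z) om i = y &
      forall i', (i' < i)%N -> traj (val z) om i' ord0 ord0 != y ord0 ord0 >].

Let source0 z : val z ord0 ord0 = 0.
Proof. by move/forallP: (valP z) => /(_ ord0) /implyP /(_ isT) /eqP. Qed.

Let level_traj z om k : traj (val z) om k ord0 ord0 = traj 0 om k ord0 ord0.
Proof. by rewrite traj_shift mxE source0 add0r. Qed.

(** All sources have first coordinate 0, so equal steps reach the level of y at the same time;
    subtracting the common displacement from y recovers the source. *)
Let hits_level_inj om y (z z' : source d.+1) : hits_level z om y -> hits_level z' om y -> z = z'.
Proof.
move=> /asboolP[i ziy imin] /asboolP[i' zi'y i'min].
have zE : traj (val z) om i ord0 ord0 = y ord0 ord0 by rewrite ziy.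
have z'E : traj (val z') om i' ord0 ord0 = y ord0 ord0 by rewrite zi'y.
have ii' : i = i'.
  case: (ltngtP i i') => // [/i'min|/imin]; rewrite level_traj.
  - by rewrite -zE level_traj eqxx.
  - by rewrite -z'E level_traj eqxx.
apply: val_inj; apply: (addIr (traj 0 om i)).
by rewrite -traj_shift ziy ii' -traj_shift zi'y.
Qed.

(** Discrete intermediate values: the first coordinate starts at 0 and moves by at most 1 at a
    time. *)
Let crosses_levels z om k (b : int) :
  0 <= b <= traj (val z) om k ord0 ord0 \/ traj (val z) om k ord0 ord0 <= b <= 0 ->
  exists2 i, (i <= k)%N & traj (val z) om i ord0 ord0 = b.
Proof.
elim: k => [|k IH].
  by rewrite traj0 source0 => hb; exists 0%N => //; rewrite traj0 source0; lia.
have [->|[e eE]] := traj_next (val z) om k.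
  by move=> /IH [i ik ib]; exists i => //; lia.
have : `|step_vector e ord0 ord0| <= 1.
  by rewrite /step_vector; case: e.2; rewrite !mxE; case: (_ && _).
set c := traj (val z) om k ord0 ord0 in IH *.
have -> : traj (val z) om k.+1 ord0 ord0 = c + step_vector e ord0 ord0 by rewrite eE mxE.
set u := step_vector e ord0 ord0 => u1 hb.
have [hb'|hb'] : (0 <= b <= c \/ c <= b <= 0) \/ b = c + u by lia.
- by have [i ik ib] := IH hb'; exists i => //; lia.
- by exists k.+1 => //; rewrite eE mxE hb'.
Qed.

(* On its way to the exit site the walk enters every intermediate level, and
   the site at which it first enters such a level belongs to the aggregate. *)
Let exit_height_le A z om x : exit_site A (traj (val z) om) = Some x ->
  2 ^+ height x <= 1 + \sum_(y <- A) (hits_level z om y)%:R * 2 ^+ height y :> R.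
Proof.
rewrite /exit_site; case E: exit_index => [k|] //= [xE].
have /exit_index_SomeP [kA kmin] := E.
have lev (a : nat) : exists y, (a < height x)%N -> [/\ y \in A, height y = a & hits_level z om y].
  case: (ltnP a (height x)) => ax; last by exists 0.
  pose b : int := if 0 <= x ord0 ord0 then a%:Z else - a%:Z.
  have bx : b <> x ord0 ord0 by rewrite /b; move: ax; rewrite /height; case: ifP; lia.
  have [|i ik ib] := @crosses_levels z om k b.
    by rewrite xE /b; move: ax; rewrite /height; case: ifP; lia.
  have ex : exists i, traj (val z) om i ord0 ord0 == b by exists i; apply/eqP.
  case: (ex_minnP ex) => j /eqP jb jmin.
  exists (traj (val z) om j) => _; split.
  - apply: kmin; have ji : (j <= i)%N by apply: jmin; apply/eqP.
    have : j <> k by move=> jk; apply: bx; rewrite -jb jk xE.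
    lia.
  - by rewrite /height jb /b; case: ifP; lia.
  - apply/asboolP; exists j => // j' j'j; rewrite jb; apply: contraTneq j'j => /eqP /jmin.
    by rewrite -leqNgt.
have [y yP] := choice lev.
(* The geometric sum 1 + (1 + 2 + ... + 2^(h-1)) = 2^h is what makes powers of 2 the right
   weight. *)
have sumE : 1 + \sum_(a <- [seq y a | a <- iota 0 (height x)])
    (hits_level z om a)%:R * 2 ^+ height a = 2 ^+ height x :> R.
  rewrite big_map (eq_big_seq (fun a => 2 ^+ a)) => [|a].
    have -> : iota 0 (height x) = index_iota 0 (height x) by rewrite /index_iota subn0.
    rewrite big_mkord; have := subrX1 (2 : R) (height x).
    by rewrite (_ : 2 - 1 = 1 :> R) ?mul1r; [move=> <-; ring|ring].
  by rewrite mem_iota add0n => /yP [_ -> ->]; rewrite mul1r.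
rewrite -[leLHS]sumE lerD2l; apply: ler_sum_sub_seq.
- by move=> i; rewrite mulr_ge0 ?exprn_ge0.
- rewrite map_inj_in_uniq ?iota_uniq // => a a'; rewrite !mem_iota !add0n /=.
  by move=> /yP[_ ha _] /yP[_ ha' _] yy; rewrite -ha -ha' yy.
- by move=> _ /mapP[a + ->]; rewrite mem_iota add0n /= => /yP[].
Qed.

(** After exchanging the sums, each site of A is charged by at most one source. *)
Lemma sum_exit_height_le A (Z : seq (source d.+1)) om : uniq Z ->
  \sum_(z <- Z) oapp (fun x => 2 ^+ height x) 0 (exit_site A (traj (val z) om)) <=
  (size Z)%:R + height_weight A.
Proof.
move=> uZ.
apply: (@le_trans _ _ (\sum_(z <- Z) (1 + \sum_(y <- A) (hits_level z om y)%:R * 2 ^+ height y))).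
  apply: ler_sum => z _; case E: exit_site => [x|] /=; first exact: exit_height_le.
  by rewrite addr_ge0 // sumr_ge0 // => y _; rewrite mulr_ge0 ?exprn_ge0.
rewrite big_split /= exchange_big /= lerD //.
  by rewrite big_const_seq count_predT iter_addr_0.
apply: ler_sum => y _; rewrite -mulr_suml -[leRHS]mul1r ler_wpM2r ?exprn_ge0 //.
by apply: sum_le1_unique => // z z' _ _; apply: hits_level_inj.
Qed.

End height_weight.

(** * Histories of binned emissions *)

Section capped_tent.
Variables (R : realFieldType) (d H : nat).
Hypothesis H_gt0 : (0 < H)%N.
Implicit Types (x : site d.+1).

(** [tent] becomes negative at great heights. Cutting it above H makes it nonnegative everywhere and
    keeps it superharmonic below H, as a step changes the height by at most 1. *)
Definition capped_tent x : R := if (height x <= H)%N then tent R H x else 0.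

Lemma capped_tent_ge0 x : 0 <= capped_tent x.
Proof. by rewrite /capped_tent; case: ifP => // /(tent_ge0 R H_gt0). Qed.

Lemma height_step x (e : 'I_d.+1 * bool) : (height (x + step_vector e) <= (height x).+1)%N.
Proof.
have aux (u v : int) : `|u|%R <= 1 -> (absz (v + u)%R <= (absz v).+1)%N by lia.
rewrite /height mxE; apply: aux; rewrite /step_vector.
by case: e.2; rewrite !mxE; case: (_ && _).
Qed.

Lemma capped_tent_superharmonic x : (height x < H)%N ->
  \sum_(e : 'I_d.+1 * bool) capped_tent (x + step_vector e) <=
    (2 * d.+1)%:R * capped_tent x.
Proof.
move=> xH; rewrite [in leRHS]/capped_tent (ltnW xH).
apply: le_trans (tent_superharmonic R H_gt0 xH); apply: ler_sum => e _.
by rewrite /capped_tent (leq_trans (height_step _ _) xH).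
Qed.

End capped_tent.

Section history.
Variable d : nat.
Local Notation step := ('I_d * bool)%type.

(** The content of one time bin: [None] for no emission, [Some (z, om)] for a single emission from z
    with steps [om]. *)
Definition letter := option (source d * seq step).

Implicit Types (keep : pred (source d)) (h : seq letter) (a : letter).

Definition add_letter keep a (AG : {fset site d} * graph d) :=
  if a is Some (z, om) then
    if keep z then add_particle AG (traj (val z) om) else AG
  else AG.

(* Histories list the latest time bin first. *)
Definition build keep h : {fset site d} * graph d :=
  foldr (add_letter keep) (fset0, Graph fset0 fset0) h.

Lemma vertices_build keep h : vertices (build keep h).2 = (build keep h).1.
Proof.
elim: h => //= -[[z om]|] h //=; case: ifP => // _.
case: (build keep h) => A [V E] /= ->; rewrite /add_particle.
by case: exit_index => [[|k]|].
Qed.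

Lemma build_sub keep h : ((build keep h).1 `<=` (build predT h).1)%fset.
Proof.
elim: h => //= -[[z om]|] h //= IH; rewrite add_particle_aggregate.
case: ifP => _; first by rewrite add_particle_aggregate; apply: add_site_sub.
apply: (fsubset_trans IH); rewrite /add_site; case: exit_site => // x.
exact: fsubsetUr.
Qed.

Lemma build_mono keep a h : ((build keep h).1 `<=` (build keep (a :: h)).1)%fset.
Proof.
case: a => [[z om]|] //=; case: ifP => // _; rewrite add_particle_aggregate /add_site.
by case: exit_site => // x; apply: fsubsetUr.
Qed.

Section discrepancy.
Variables (K : nat) (keep : pred (source d)).

Definition discrepancy h : bool :=
  has (in_strip K) ((build predT h).1 `\` (build keep h).1)%fset.

Fixpoint ever_discrepancy h : bool :=
  if h is a :: h' then ever_discrepancy h' || discrepancy h else false.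

Lemma ever_discrepancyN h : ~~ ever_discrepancy h -> ~~ discrepancy h.
Proof.
case: h => [_|a h]; last by rewrite /= negb_or => /andP[].
by apply/hasPn => x; rewrite inE.
Qed.

Lemma discrepancyN h : ~~ discrepancy h -> forall x, in_strip K x ->
  (x \in (build predT h).1) = (x \in (build keep h).1).
Proof.
move=> /hasPn nd x xK; apply/idP/idP; last exact: (fsubsetP (build_sub keep h)).
by move=> xA'; apply: contraLR xK => xA; apply: nd; rewrite inE xA.
Qed.

Definition strip_edges (G : graph d) :=
  [fset e in edges G | in_strip K e.1 && in_strip K e.2]%fset.

Lemma strip_edges_add (AG : {fset site d} * graph d) s :
  (forall y, exit_site AG.1 s = Some y -> ~~ in_strip K y) ->
  strip_edges (add_particle AG s).2 = strip_edges AG.2.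
Proof.
case: AG => A [V E]; rewrite /exit_site /add_particle /=.
case: exit_index => [[|k]|] //= /(_ _ erefl) yK; apply/fsetP => e; rewrite !inE.
by case: (e =P _) => [->|] //=; rewrite (negbTE yK) !andbF.
Qed.

Lemma strip_edges_add_same (AG AG' : {fset site d} * graph d) s :
  exit_index AG'.1 s = exit_index AG.1 s -> strip_edges AG.2 = strip_edges AG'.2 ->
  strip_edges (add_particle AG s).2 = strip_edges (add_particle AG' s).2.
Proof.
case: AG AG' => A [V E] [A' [V' E']]; rewrite /add_particle /= => ->.
case: exit_index => [[|k]|] //= EE; apply/fsetP => e.
move/fsetP: EE => /(_ e); rewrite !inE /=.
by case: (e =P _) => [->|].
Qed.

(** An edge is created together with the site at its end. If the small aggregate is left at a site
    outside the large one, both forests gain the same edge. If it is left at an excess site, that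
    site is outside the strip, and so is the exit site of the large aggregate, which would otherwise
    be a new excess site in the strip. The same holds for the exit site of an extra particle. *)
Lemma restrict_strip_build h : ~~ ever_discrepancy h ->
  restrict_strip K (build keep h).2 = restrict_strip K (build predT h).2.
Proof.
move=> nbad; rewrite /restrict_strip; congr Graph.
  apply/fsetP => x; rewrite !inE !vertices_build.
  by case: (boolP (in_strip K x)) => [xK|]; rewrite ?andbF // (discrepancyN (ever_discrepancyN nbad)).
rewrite -/(strip_edges _) -/(strip_edges _).
elim: h nbad => // a h IH; rewrite [ever_discrepancy _]/= negb_or => /andP[nb /discrepancyN].
have /discrepancyN := ever_discrepancyN nb.
move: a (IH nb) (build_sub keep h) => [[z om]|] //= {}IH sub; set AG := build keep h in IH sub *.
set AG' := build predT h in IH sub *; set s := traj _ _ => nd; rewrite !add_particle_aggregate.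
have newN y : exit_site AG'.1 s = Some y -> y \in add_site AG'.1 (exit_site AG'.1 s).
  by move=> ->; rewrite !inE eqxx.
have newA y : exit_site AG'.1 s = Some y -> y \notin AG.1.
  by move=> /exit_site_notin; apply: contraNN => /(fsubsetP sub).
case: ifP => _; last first.
  move=> nd'; rewrite strip_edges_add // => y ey; apply/negP => yK.
  by have := newA _ ey; rewrite -nd' // newN.
rewrite add_particle_aggregate => nd'; have := exit_site_sub s sub.
case E: (exit_site AG.1 s) => [x|] => [xx|E'].
  case: (boolP (x \in AG'.1)) => xA'; last by apply: strip_edges_add_same => //; apply: xx.
  have xA := exit_site_notin E.
  rewrite !strip_edges_add // => y ey; apply/negP => yK.
    have := newN _ ey; rewrite nd' // E /= !inE (negbTE (newA _ ey)) orbF => /eqP yx.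
    by have := exit_site_notin ey; rewrite yx xA'.
  by move: ey xA; rewrite E => -[yx]; rewrite -nd ?xA' // yx.
by rewrite !strip_edges_add // => y; rewrite ?E ?E'.
Qed.

End discrepancy.

Section mean.
Variables (R : realFieldType) (Z : seq (source d)) (T : nat) (p0 p1 : R).

Definition letters : seq letter := None :: [seq Some (z, om) | z <- Z, om <- paths d T].

Fixpoint histories (B : nat) : seq (seq letter) :=
  if B is B'.+1 then [seq a :: h | h <- histories B', a <- letters] else [:: [::]].

Definition weight h : R := \prod_(a <- h) (if a is Some _ then p1 else p0).

(** Not normalised: bins with several emissions have no letter, so the total weight may be less than
    1. *)
Definition mean B (f : seq letter -> R) : R := \sum_(h <- histories B) weight h * f h.

Lemma mean0 f : mean 0 f = f [::].
Proof. by rewrite /mean /= big_seq1 /weight big_nil mul1r. Qed.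

Lemma meanS B f : mean B.+1 f = mean B (fun h => p0 * f (None :: h) +
  p1 * \sum_(z <- Z) \sum_(om <- paths d T) f (Some (z, om) :: h)).
Proof.
rewrite /mean (_ : histories B.+1 = [seq a :: h | h <- histories B, a <- letters]) //.
rewrite big_allpairs_dep; apply: eq_bigr => h _.
rewrite /letters big_cons mulrDr; congr (_ + _).
  by rewrite /weight big_cons mulrA (mulrC _ p0).
rewrite big_allpairs_dep mulrA mulr_sumr; apply: eq_bigr => z _.
rewrite mulr_sumr; apply: eq_bigr => om _.
by rewrite /weight big_cons (mulrC _ p1).
Qed.

Hypothesis p0_ge0 : 0 <= p0.
Hypothesis p1_ge0 : 0 <= p1.

Lemma weight_ge0 h : 0 <= weight h.
Proof. by apply: prodr_ge0 => -[?|] _. Qed.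

Lemma le_mean B f g : (forall h, f h <= g h) -> mean B f <= mean B g.
Proof. by move=> fg; apply: ler_sum => h _; rewrite ler_wpM2l ?weight_ge0. Qed.

Lemma meanD B f g : mean B (fun h => f h + g h) = mean B f + mean B g.
Proof. by rewrite /mean -big_split; apply: eq_bigr => h _; rewrite mulrDr. Qed.

Lemma meanZ B c f : mean B (fun h => c * f h) = c * mean B f.
Proof. by rewrite /mean mulr_sumr; apply: eq_bigr => h _; rewrite mulrCA. Qed.

Let P : R := ((2 * d) ^ T)%:R.
Let total : R := p0 + p1 * P * (size Z)%:R.

Lemma sum_const_letters (c : R) :
  \sum_(z <- Z) \sum_(om <- paths d T) c = (P * (size Z)%:R) * c.
Proof.
rewrite big_const_seq count_predT iter_addr_0 big_const_seq count_predT iter_addr_0 size_paths.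
by rewrite /P -mulr_natr -(mulr_natl c); ring.
Qed.

Lemma mean_cst B c : mean B (fun=> c) = total ^+ B * c.
Proof.
elim: B c => [|B IH] c; first by rewrite mean0 expr0 mul1r.
rewrite meanS sum_const_letters; under [X in mean B X]eq_fun do rewrite mulrA -mulrDl mulrA.
by rewrite IH exprSr mulrA.
Qed.

End mean.

End history.

(** * Mean growth of heights and of the excess *)

Section mean_bounds.
Variables (R : realFieldType) (d : nat) (Z : seq (source d.+1)) (T : nat) (p0 p1 : R).
Hypothesis Z_uniq : uniq Z.
Hypothesis p0_ge0 : 0 <= p0.
Hypothesis p1_ge0 : 0 <= p1.

Let P : R := ((2 * d.+1) ^ T)%:R.
Let rate : R := p1 * P.
Hypothesis total_le1 : p0 + rate * (size Z)%:R <= 1.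

Local Notation mean := (mean Z T p0 p1).

Let rate_ge0 : 0 <= rate. Proof. by rewrite mulr_ge0 ?ler0n. Qed.

Let mean_cst_le B (c : R) : 0 <= c -> mean B (fun=> c) <= c.
Proof.
move=> c0; rewrite mean_cst -[leRHS]mul1r ler_wpM2r // exprn_ile1 //.
by rewrite addr_ge0 // mulr_ge0 // mulr_ge0 // ler0n.
Qed.

(** For fixed steps, the sum over all sources of the weight gained is at most |Z| plus the present
    weight. Hence the weight plus |Z| grows on average by a factor at most 1 + [rate] per bin,
    starting from |Z|. *)
Lemma mean_height_weight B :
  mean B (fun h => height_weight R (build predT h).1) <=
    (size Z)%:R * ((1 + rate) ^+ B - 1).
Proof.
elim: B => [|B IH]; first by rewrite mean0 expr0 subrr mulr0 /height_weight big_seq_fset0.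
rewrite meanS.
pose W (h : seq (letter d.+1)) := height_weight R (build predT h).1.
apply: (@le_trans _ _ (mean B (fun h => (1 + rate) * W h + rate * (size Z)%:R))).
  apply: le_mean => // h; rewrite exchange_big /=.
  set A := (build predT h).1.
  have step om : \sum_(z <- Z)
      height_weight R (add_particle (build predT h) (traj (val z) om)).1 <=
      (size Z)%:R * W h + ((size Z)%:R + W h).
    under eq_bigr => z _.
      rewrite add_particle_aggregate -/A.
      rewrite (_ : height_weight R _ = W h +
        oapp (fun x => 2 ^+ height x) 0 (exit_site A (traj (val z) om))).
      over.
      case E: exit_site => [x|] /=; last by rewrite addr0.
      by rewrite height_weight_add ?(exit_site_notin E) // addrC.
    rewrite big_split /= big_const_seq count_predT iter_addr_0 mulr_natl lerD2l.
    exact: sum_exit_height_le.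
  apply: (@le_trans _ _ (p0 * W h + p1 * \sum_(om <- paths d.+1 T)
      ((size Z)%:R * W h + ((size Z)%:R + W h)))).
    by rewrite lerD2l ler_wpM2l // ler_sum.
  rewrite big_const_seq count_predT iter_addr_0 size_paths -[_ *+ (_ ^ T)%N]mulr_natr -/P.
  have W0 : 0 <= W h by apply: height_weight_ge0.
  have -> : p0 * W h + p1 * (((size Z)%:R * W h + ((size Z)%:R + W h)) * P) =
     (p0 + rate * (size Z)%:R + rate) * W h + rate * (size Z)%:R by rewrite /rate; ring.
  by rewrite lerD2r ler_wpM2r // lerD2r.
rewrite meanD meanZ.
apply: (@le_trans _ _ ((1 + rate) * ((size Z)%:R * ((1 + rate) ^+ B - 1)) + rate * (size Z)%:R)).
  rewrite lerD ?mean_cst_le ?mulr_ge0 ?ler0n //.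
  by rewrite ler_wpM2l // addr_ge0.
by rewrite exprS le_eqVlt; apply/predU1P; left; ring.
Qed.

Variables (H K M : nat).
Hypothesis H_gt0 : (0 < H)%N.

Let keep := [pred z : source d.+1 | in_sources M z].
Let phi : site d.+1 -> R := capped_tent R H.
Let flat (A : {fset site d.+1}) := all (fun x => height x < H)%N A.

Fixpoint stopped_excess (h : seq (letter d.+1)) : R :=
  if h is _ :: h' then
    if ever_discrepancy K keep h' then stopped_excess h'
    else excess phi (build keep h).1 (build predT h).1
  else 0.

Lemma excess_ge0 (A A' : {fset site d.+1}) : 0 <= excess phi A A'.
Proof. by apply: sumr_ge0 => x _; apply: capped_tent_ge0. Qed.

Lemma stopped_excess_ge0 h : 0 <= stopped_excess h.
Proof. by elim: h => //= a h IH; case: ifP => // _; apply: excess_ge0. Qed.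

Lemma stopped_excessE h : ~~ ever_discrepancy K keep h ->
  stopped_excess h = excess phi (build keep h).1 (build predT h).1.
Proof.
case: h => [_|a h]; last by rewrite /= negb_or => /andP[/negbTE -> _].
by rewrite /excess /= fsetD0 big_seq_fset0.
Qed.

Lemma flat_sub (A A' : {fset site d.+1}) : (A `<=` A')%fset -> flat A' -> flat A.
Proof. by move=> /fsubsetP AA' /allP A'f; apply/allP => x /AA' /A'f. Qed.

Let c : R := H%:R ^+ 2 * decay R d H ^+ (d * K).

Lemma stopped_excess_ge h : flat (build predT h).1 -> ever_discrepancy K keep h ->
  c <= stopped_excess h.
Proof.
elim: h => // a h IH fl /=; case: ifP => [eh _|_ /= /hasP[x xD xK]].
  by apply: IH => //; apply: flat_sub fl; apply: build_mono.
rewrite /excess (big_fsetD1 x xD) /=; apply: ler_wpDr; first exact: excess_ge0.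
have xH : (height x < H)%N by move/allP: fl; apply; move: xD; rewrite inE => /andP[].
by rewrite /phi /capped_tent (ltnW xH); exact: tent_lower.
Qed.

(** Superharmonicity holds only below height H, so the excess is set to 0 once the large aggregate
    gets there; aggregates grow, so it stays 0. *)
Let flat_excess (h : seq (letter d.+1)) : R := if flat (build predT h).1 then stopped_excess h else 0.
Let extra : R := 2 * H%:R ^+ 2 * decay R d H ^+ M.+1.

Let extra_ge0 : 0 <= extra.
Proof. by rewrite !mulr_ge0 ?exprn_ge0 ?ler0n // ltW // decay_gt0. Qed.

(** A kept source replaces [phi] at the exit site of A by [phi] at that of the larger A', a loss in
    the mean by [exit_sum_anti]. An extra source adds on average at most [phi] at the source, hence
    at most [extra]. *)
Lemma sum_flat_excess_le z h :
  \sum_(om <- paths d.+1 T) flat_excess (Some (z, om) :: h) <=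
    P * (flat_excess h + extra).
Proof.
have sum_cst (r : R) : \sum_(om <- paths d.+1 T) r = P * r.
  by rewrite big_const_seq count_predT iter_addr_0 size_paths mulr_natl.
have ext0 : 0 <= P * extra by rewrite mulr_ge0 ?ler0n.
rewrite {2}/flat_excess; case: ifPn => [fl|nfl]; last first.
  rewrite add0r big1 // => om _; rewrite /flat_excess.
  by rewrite ifN //; apply: contraNN nfl; apply: flat_sub; apply: build_mono.
apply: (@le_trans _ _ (\sum_(om <- paths d.+1 T) stopped_excess (Some (z, om) :: h))).
  by apply: ler_sum => om _; rewrite /flat_excess; case: ifP => // _; apply: stopped_excess_ge0.
have [eh|neh] := boolP (ever_discrepancy K keep h).
  under eq_bigr do rewrite /= eh.
  by rewrite sum_cst mulrDr lerDl.
rewrite (stopped_excessE neh) /= (negbTE neh).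
have sub := build_sub keep h.
set A := (build keep h).1 in sub *; set A' := (build predT h).1 in sub fl *.
have A'C : {subset A' <= (fun x : site d.+1 => (height x < H)%N)}.
  by move=> x xA'; exact: (allP fl x xA').
have super := @capped_tent_superharmonic R d H H_gt0.
have phi0 x : (height x < H)%N -> 0 <= phi x by move=> _; apply: capped_tent_ge0.
have [kz|nkz] := boolP (in_sources M z).
  under eq_bigr do rewrite !add_particle_aggregate excess_add //.
  rewrite !big_split /= sum_cst sumrN -addrA mulrDr lerD2l.
  apply: (@le_trans _ _ 0) => //; rewrite addrC subr_le0.
  exact: (exit_sum_anti super phi0).
under eq_bigr do rewrite !add_particle_aggregate excess_add_extra //.
rewrite !big_split /= sum_cst mulrDr lerD2l.
apply: (le_trans (exit_sum_le super phi0 T (val z) A'C)).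
rewrite ler_wpM2l ?ler0n // /capped_tent; case: ifP => // _.
exact: tent_upper.
Qed.

Lemma mean_flat_excess B :
  mean B flat_excess <= B%:R * (rate * (size Z)%:R * extra).
Proof.
have fe0 h : 0 <= flat_excess h.
  by rewrite /flat_excess; case: ifP => // _; apply: stopped_excess_ge0.
elim: B => [|B IH]; first by rewrite mean0 mul0r /flat_excess /=.
rewrite meanS.
apply: (@le_trans _ _ (mean B (fun h => flat_excess h + rate * (size Z)%:R * extra))).
  apply: le_mean => // h.
  apply: (@le_trans _ _ (p0 * flat_excess h + p1 * \sum_(z <- Z) P * (flat_excess h + extra))).
    apply: lerD; last by rewrite ler_wpM2l //; apply: ler_sum => z _; apply: sum_flat_excess_le.
    rewrite ler_wpM2l // {1}/flat_excess /=; case: ifP => // fl.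
    rewrite /flat_excess fl; case: ifPn => // neh.
    by rewrite stopped_excessE.
  rewrite big_const_seq count_predT iter_addr_0 -[_ *+ size Z]mulr_natr.
  have -> : p0 * flat_excess h + p1 * (P * (flat_excess h + extra) * (size Z)%:R) =
    (p0 + rate * (size Z)%:R) * flat_excess h + rate * (size Z)%:R * extra by rewrite /rate; ring.
  by rewrite lerD2r ler_piMl.
rewrite meanD -[B.+1]addn1 natrD mulrDl mul1r lerD //.
by rewrite mean_cst_le // mulr_ge0 // mulr_ge0 // ler0n.
Qed.

Lemma ever_discrepancy_le h : (ever_discrepancy K keep h)%:R <=
  height_weight R (build predT h).1 * 2 ^- H + c^-1 * flat_excess h.
Proof.
have c0 : 0 < c by rewrite mulr_gt0 ?exprn_gt0 ?ltr0n ?decay_gt0.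
have W0 := height_weight_ge0 R (build predT h).1.
have fe0 : 0 <= flat_excess h.
  by rewrite /flat_excess; case: ifP => // _; apply: stopped_excess_ge0.
have rhs0 : 0 <= height_weight R (build predT h).1 * 2 ^- H + c^-1 * flat_excess h.
  by rewrite addr_ge0 ?mulr_ge0 ?invr_ge0 ?exprn_ge0 // ltW.
case: (boolP (ever_discrepancy K keep h)) => eh //=.
have [fl|] := boolP (flat (build predT h).1).
  apply: ler_wpDl; first by rewrite mulr_ge0 ?invr_ge0 ?exprn_ge0.
  by rewrite /flat_excess fl mulrC ler_pdivlMr // mul1r stopped_excess_ge.
move=> /allPn[x xA]; rewrite -leqNgt => Hx.
apply: ler_wpDr; first by rewrite mulr_ge0 ?invr_ge0 // ltW.
rewrite ler_pdivlMr ?exprn_gt0 // mul1r (le_trans _ (height_weight_ge R xA)) //.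
by rewrite ler_weXn2l ?ler1n.
Qed.

Lemma mean_ever_discrepancy B :
  mean B (fun h => (ever_discrepancy K keep h)%:R) <=
    (size Z)%:R * (1 + rate) ^+ B * 2 ^- H +
    B%:R * rate * (size Z)%:R * (2 * decay R d H ^+ M.+1 / decay R d H ^+ (d * K)).
Proof.
have q0 := decay_gt0 R d H_gt0.
apply: (@le_trans _ _ _ _ _ (le_mean _ _ p0_ge0 p1_ge0 B ever_discrepancy_le)).
rewrite meanD; apply: lerD.
  under [X in mean B X]eq_fun do rewrite mulrC.
  rewrite meanZ mulrC ler_wpM2r ?invr_ge0 ?exprn_ge0 //.
  apply: (le_trans (mean_height_weight B)).
  by rewrite ler_wpM2l ?ler0n // gerBl.
rewrite meanZ; have c0 : 0 < c by rewrite mulr_gt0 ?exprn_gt0 ?ltr0n.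
rewrite mulrC ler_pdivrMr // (le_trans (mean_flat_excess B)) //.
rewrite le_eqVlt; apply/predU1P; left; rewrite /extra /c; field.
by rewrite expf_neq0 // gt_eqF.
Qed.

End mean_bounds.

(** * Laws of walks and of bin counts *)

Section probability.
Context {R : realType} {disp : measure_display} {Omega : measurableType disp}.
Variable P : probability Omega R.

Lemma mutually_independent_seq (I : choiceType) (F : I -> set (set Omega))
    (s : seq I) (E : I -> set Omega) (p : I -> R) :
  mutually_independent P F -> uniq s -> {in s, forall i, F i (E i)} ->
  {in s, forall i, P (E i) = (p i)%:E} ->
  P (\bigcap_(i in [set` s]) E i) = (\prod_(i <- s) p i)%:E.
Proof.
move=> indep us FE PE; have := indep [fset i in s]%fset E.
have -> : [set` [fset i in s]%fset] = [set` s] by apply/seteqP; split=> i /=; rewrite !inE.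
move=> ->; last by move=> i; rewrite !inE; apply: FE.
rewrite (perm_big s) /=; last by apply: uniq_perm => // i; rewrite !inE.
rewrite (eq_big_seq (fun i => (p i)%:E)) //.
by elim: s {us FE PE indep} => [|i s IH]; rewrite ?big_nil // !big_cons IH EFinM.
Qed.

Section walk.
Variables (d : nat) (x : site d) (X : nat -> Omega -> site d).
Hypothesis X_walk : simple_random_walk P x X.

Definition follows T (om : seq ('I_d * bool)) : set Omega :=
  [set w | forall k, (k <= T)%N -> X k w = traj x om k].

Lemma follows_prob T om : om \in paths d T ->
  P (follows T om) = (((2 * d) ^ T)%:R^-1)%:E.
Proof.
rewrite mem_paths => /eqP szT; case: X_walk => Xm X0 Xstep Xindep.
pose incr k : site d := traj x om k.+1 - traj x om k.
pose E k : set Omega := [set w | increment X k w = incr k].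
have -> : follows T om = \bigcap_(k in [set` iota 0 T]) E k.
  apply/seteqP; split => w /= h.
    by move=> k /=; rewrite mem_iota add0n /= => kT; rewrite /E /= /increment !h // ltnW.
  elim=> [|k IH] kT; first by rewrite X0 traj0.
  have := h k; rewrite /= mem_iota add0n /= => /(_ kT); rewrite /E /= /increment /incr.
  by rewrite IH ?(ltnW kT) // => /addIr.
rewrite (@mutually_independent_seq _ _ _ _ (fun=> ((2 * d)%:R)^-1) Xindep (iota_uniq 0 T)).
- rewrite big_const_seq count_predT size_iota natrX -exprVn; congr _%:E.
  by elim: T {szT} => //= T ->; rewrite exprS.
- by move=> k _; exists [set incr k] => //; rewrite setTI.
- move=> k; rewrite mem_iota add0n /= => kT; apply: Xstep.
  have [|[i b] ke] := @traj_step _ om x k; first by rewrite szT.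
  rewrite /incr ke addrC addrA addNr add0r /step_vector /=.
  by exists i; case: (b); [right|left].
Qed.

Lemma follows_sigma T om : sigma_walk X (follows T om).
Proof.
have -> : follows T om = \bigcap_k [set w | (k <= T)%N -> X k w = traj x om k].
  by apply/seteqP; split=> w /= h k; [move=> _; apply: h|apply: h].
apply: (@bigcapT_measurable _ (g_sigma_algebraType
  (\bigcup_k preimage_set_system setT (X k) setT))) => k.
apply: sub_sigma_algebra; exists k => //.
case: (leqP k T) => kT; last by exists setT => //; rewrite setTI; apply/seteqP; split.
by exists [set traj x om k] => //; rewrite setTI; apply/seteqP; split=> // w /= ->.
Qed.

Lemma follows_measurable T om : measurable (follows T om).
Proof.
have -> : follows T om = \bigcap_k [set w | (k <= T)%N -> X k w = traj x om k].
  by apply/seteqP; split=> w /= h k; [move=> _; apply: h|apply: h].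
apply: bigcapT_measurable => k; case: (leqP k T) => kT; last first.
  by rewrite [X in measurable X](_ : _ = setT) //; apply/seteqP; split.
rewrite [X in measurable X](_ : _ = [set w | X k w = traj x om k]).
  by case: X_walk.
by apply/seteqP; split=> w /=; [move=> /(_ isT)|].
Qed.

End walk.

Section bins.
Variables (delta : R) (X : Omega -> set R).
Hypothesis delta_gt0 : 0 < delta.
Hypothesis X_poisson : poisson_process P 1 X.

(** Half-open, so the first B bins partition [0, B delta[; a point at the final time is a null event
    treated apart. *)
Definition bin (i : nat) : set R := `[i%:R * delta, i.+1%:R * delta[.

Lemma bin_sub i : bin i `<=` half_line.
Proof.
move=> t; rewrite /bin /half_line /= !in_itv /= => /andP[h _]; rewrite andbT.
by apply: le_trans h; rewrite mulr_ge0 ?ler0n ?(ltW delta_gt0).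
Qed.

Lemma bin_trivIset : trivIset setT bin.
Proof.
apply: ltn_trivIset => i j ij; apply/seteqP; split=> // t [].
rewrite /bin /= !in_itv /= => /andP[_ ti] /andP[jt _].
have : j.+1%:R * delta <= i%:R * delta by rewrite ler_wpM2r ?ler_nat ?(ltW delta_gt0).
by lra.
Qed.

Lemma poisson_count_prob i (b : bool) :
  P [set w | npoints X (bin i) w = b%:R%:E] = (expR (- delta) * delta ^+ b)%:E.
Proof.
case: X_poisson => _ _ Xlaw _.
have leb : lebesgue_measure (bin i) = delta%:E.
  rewrite lebesgue_measure_itv /= lte_fin ltr_pM2r // ltr_nat ltnSn -EFinB.
  by congr _%:E; rewrite -natr1; ring.
rewrite (Xlaw (bin i)); [|exact: measurable_itv|exact: bin_sub|by rewrite leb ltry].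
rewrite leb.
rewrite /= mul1r /poisson_prob delta_gt0 esum_set1; last first.
  by rewrite lee_fin poisson_pmf_ge0.
rewrite /poisson_pmf delta_gt0; congr _%:E; rewrite mulrC; congr (_ * _).
by case: b; rewrite (_ : (nat_of_bool _)`! = 1%N) // invr1 mulr1.
Qed.

Definition bin_counts B (c : nat -> bool) : set Omega :=
  [set w | forall i, (i < B)%N -> npoints X (bin i) w = (c i)%:R%:E].

Lemma bin_counts_prob B c :
  P (bin_counts B c) = (\prod_(i < B) (expR (- delta) * delta ^+ c i))%:E.
Proof.
case: X_poisson => _ _ _ Xindep.
have tI : trivIset setT (fun i : 'I_B => bin i).
  by move=> i j _ _ ij; apply/val_inj; exact: bin_trivIset ij.
have indep := Xindep B (fun i : 'I_B => bin i) (fun i => measurable_itv _) (fun i => @bin_sub i) tI.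
have -> : bin_counts B c = \bigcap_(i in [set` index_enum 'I_B])
    [set w | npoints X (bin (i : 'I_B)) w = (c i)%:R%:E].
  apply/seteqP; split=> w /= h i.
    by move=> _; apply: h.
  by move=> iB; apply: (h (Ordinal iB)); rewrite /= mem_index_enum.
rewrite (mutually_independent_seq (p := fun i : 'I_B => expR (- delta) * delta ^+ c i)
   indep) //.
- exact: index_enum_uniq.
- by move=> i _; exists [set (c i)%:R%:E] => //; rewrite setTI.
- by move=> i _; apply: poisson_count_prob.
Qed.

Lemma bin_counts_sigma B c : sigma_process X (bin_counts B c).
Proof.
have -> : bin_counts B c =
    \bigcap_i [set w | (i < B)%N -> npoints X (bin i) w = (c i)%:R%:E].
  by apply/seteqP; split=> w /= h k; [move=> _; apply: h|apply: h].
apply: (@bigcapT_measurable _ (g_sigma_algebraType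
  (\bigcup_(B in [set B : set R | measurable B /\ B `<=` half_line])
    preimage_set_system setT (npoints X B) measurable))) => i.
apply: sub_sigma_algebra; exists (bin i); first by split; [exact: measurable_itv|exact: bin_sub].
case: (ltnP i B) => iB; last by exists setT => //; rewrite setTI; apply/seteqP; split.
exists [set (c i)%:R%:E]; first exact: emeasurable_set1.
by rewrite setTI; apply/seteqP; split=> // w /= ->.
Qed.

Lemma bin_counts_measurable B c : measurable (bin_counts B c).
Proof.
case: X_poisson => _ Xm _ _.
have -> : bin_counts B c =
    \bigcap_i [set w | (i < B)%N -> npoints X (bin i) w = (c i)%:R%:E].
  by apply/seteqP; split=> w /= h k; [move=> _; apply: h|apply: h].
apply: bigcapT_measurable => i; case: (ltnP i B) => iB; last first.
  by rewrite [X in measurable X](_ : _ = setT) //; apply/seteqP; split.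
have mX := Xm (bin i) (measurable_itv _) (@bin_sub i).
have := mX measurableT [set (c i)%:R%:E] (emeasurable_set1 _); rewrite setTI => h.
rewrite [X in measurable X](_ : _ = npoints X (bin i) @^-1` [set (c i)%:R%:E]); first exact: h.
by apply/seteqP; split=> w /=; [move=> /(_ isT)|].
Qed.

End bins.

End probability.

(** * Emission lists *)

Section numbering.
Variable d : nat.
Local Notation step := ('I_d * bool)%type.
Implicit Types (h : seq (letter d)) (a : letter d) (z : source d).

Definition emits a z : bool := if a is Some (z', _) then z' == z else false.

Definition emission_count z h : nat := count (emits^~ z) h.

(** The tail of a history is its past, so the emissions of z counted there are the index, from 0, of
    the particle emitted next. *)
Fixpoint numbered h : seq ((source d * nat) * seq step) :=
  if h is a :: h' then
    if a is Some (z, om) then ((z, emission_count z h'), om) :: numbered h'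
    else numbered h'
  else [::].

Definition particles h : seq (source d * nat) := map fst (numbered h).

Lemma mem_particles h p : (p \in particles h) = (p.2 < emission_count p.1 h)%N.
Proof.
rewrite /particles /emission_count; case: p => z' j /=.
elim: h => //= -[[z om]|] h IH //=; rewrite inE IH xpair_eqE /= [z' == z]eq_sym.
case: eqP => [->|] /=; last by rewrite add0n.
by rewrite add1n ltnS [RHS]leq_eqVlt.
Qed.

Lemma particles_uniq h : uniq (particles h).
Proof.
rewrite /particles; elim: h => //= -[[z om]|] h IH //=.
by rewrite -/(particles h) mem_particles ltnn.
Qed.

Definition label h (p : source d * nat) : seq step :=
  nth [::] (map snd (numbered h)) (index p (particles h)).

Lemma label_numbered h x : x \in numbered h -> label h x.1 = x.2.
Proof.
move=> xh; have [i ih <-] := nthP x xh.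
rewrite /label /particles -(nth_map x x.1) // index_uniq ?size_map ?particles_uniq //.
by rewrite (nth_map x).
Qed.

Lemma numbered_mem h x : x \in numbered h -> Some (x.1.1, x.2) \in h.
Proof.
elim: h => //= -[[z om]|] h IH; rewrite !inE /=; last by move=> /IH ->.
by case/orP => [/eqP -> /=|/IH ->]; rewrite ?eqxx ?orbT.
Qed.

Lemma particle_label h p : p \in particles h -> (p, label h p) \in numbered h.
Proof. by move=> /mapP[x xh ->]; rewrite (label_numbered xh); case: x xh. Qed.

End numbering.

Lemma counting_bool (R : realType) (T : choiceType) (A : set T) (b : bool) :
  counting A = b%:R%:E :> \bar R -> if b then exists x, A = [set x] else A = set0.
Proof.
rewrite /counting; case: asboolP => // fA [] /eqP; rewrite eqr_nat => /eqP.
case: b => /= [/eqP/cardfs1P[x Ax]|/cardfs0_eq].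
- by exists x; rewrite -(fset_setK fA) Ax set_fset1.
- exact: fset_set_set0.
Qed.

Section emission_times.
Variables (R : realType) (d : nat) (t : source d -> nat -> R) (X : source d -> set R).
Variables (delta : R) (Z : seq (source d)).
Hypothesis delta_gt0 : 0 < delta.
Hypothesis t_points : {in Z, forall z, successive_points (X z) (t z)}.
Hypothesis X_half : {in Z, forall z, X z `<=` half_line}.

(** The list is reversed because histories put the latest bin first. *)
Definition matches_counts (h : seq (letter d)) : Prop :=
  forall z, z \in Z -> forall i, (i < size h)%N ->
    counting (X z `&` bin delta i) = (emits (nth None (rev h) i) z)%:R%:E :> \bar R.

Lemma matches_counts_cons a h : matches_counts (a :: h) <->
  matches_counts h /\ forall z, z \in Z ->
    counting (X z `&` bin delta (size h)) = (emits a z)%:R%:E :> \bar R.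
Proof.
rewrite /matches_counts; split=> [m|[m ma] z zZ i].
- split=> z zZ.
    move=> i ih; rewrite m //= ?rev_cons ?nth_rcons ?size_rev ?ih //; exact: ltnW.
  by rewrite m //= rev_cons nth_rcons size_rev ltnn eqxx.
- rewrite /= ltnS rev_cons nth_rcons size_rev leq_eqVlt => /predU1P[->|ih].
    by rewrite ltnn eqxx ma.
  by rewrite ih m.
Qed.

Let t_incr z i j : z \in Z -> (i < j)%N -> t z i < t z j.
Proof.
move=> zZ; have [incr _] := t_points zZ.
elim: j => // j IH; rewrite ltnS leq_eqVlt => /predU1P[->//|/IH ij].
exact: lt_trans (incr j).
Qed.

(** Induction on bins: if the next bin holds a point of z, it is the only one there, and being the
    first point after the earlier bins it has index [emission_count z h]. *)
Lemma emission_time_lt h z j : matches_counts h -> z \in Z ->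
  (t z j < (size h)%:R * delta) = (j < emission_count z h)%N.
Proof.
elim: h j => [|a h IH] j.
  move=> _ zZ; rewrite /emission_count /= mul0r ltn0; apply/negbTE; rewrite -leNgt.
  have [_ rt] := t_points zZ.
  have : half_line (t z j) by apply: (X_half zZ); rewrite -rt; exists j.
  by rewrite /half_line /= in_itv /= andbT.
move=> /matches_counts_cons[m ma] zZ; have {}IH i := IH i m zZ.
have [_ rt] := t_points zZ.
have inX i : X z (t z i) by rewrite -rt; exists i.
have inbin i : bin delta (size h) (t z i) =
    (((size h)%:R * delta <= t z i) && (t z i < (size h).+1%:R * delta)) :> Prop.
  by rewrite /bin /= in_itv.
have mono : (size h)%:R * delta < (size h).+1%:R * delta by rewrite ltr_pM2r // ltr_nat.
rewrite /emission_count /= -/(emission_count z h).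
have := counting_bool (ma z zZ); case: (emits a z) => /= [[x Xx]|X0]; last first.
  rewrite add0n -IH; apply/idP/idP => [tj|]; last by move=> /lt_trans; apply.
  rewrite ltNge; apply/negP => tj'.
  suff : (X z `&` bin delta (size h)) (t z j) by rewrite X0.
  by split=> //; rewrite inbin tj' tj.
have : (X z `&` bin delta (size h)) x by rewrite Xx.
move=> [+ xb]; rewrite -rt => -[k _ kx].
have uniq_in i : bin delta (size h) (t z i) -> t z i = x.
  by move=> ib; have : (X z `&` bin delta (size h)) (t z i) by []; rewrite Xx.
move: xb; rewrite -kx inbin => /andP[k1 k2].
have kc : k = emission_count z h.
  have : (emission_count z h <= k)%N by rewrite leqNgt -IH -leNgt.
  rewrite leq_eqVlt => /predU1P[//|ck].
  have := t_incr zZ ck; have -> : t z k = t z (emission_count z h).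
    rewrite kx uniq_in // inbin leNgt IH ltnn /=.
    exact: lt_trans (t_incr zZ ck) k2.
  by rewrite ltxx.
rewrite add1n ltnS -kc; case: (ltngtP j k) => jk.
- exact: lt_trans (t_incr zZ jk) k2.
- apply/negbTE/negP => tj; have := t_incr zZ jk.
  by rewrite kx uniq_in ?ltxx // inbin tj andbT (le_trans k1) // ltW // t_incr.
- by rewrite jk k2.
Qed.

Let valid (h : seq (letter d)) := all (fun a => if a is Some (z, _) then z \in Z else true) h.

Lemma particle_source h p : valid h -> p \in particles h -> p.1 \in Z.
Proof. by move=> /allP vh /particle_label /numbered_mem /vh. Qed.

Lemma particles_sorted h : valid h -> matches_counts h ->
  sorted (fun p q => t q.1 q.2 < t p.1 p.2) (particles h).
Proof.
elim: h => // a h IH /= /andP[va vh] /matches_counts_cons[m ma].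
case: a va ma => [[z om]|] /= zZ ma; last exact: IH.
have tr : transitive (fun p q : source d * nat => t q.1 q.2 < t p.1 p.2).
  by move=> ? ? ? /[swap]; apply: lt_trans.
rewrite /particles /= path_sortedE // -/(particles h) IH // andbT.
apply/allP => p ph /=; have pZ := particle_source vh ph.
rewrite mem_particles -(emission_time_lt _ m pZ) in ph.
by apply: (lt_le_trans ph); rewrite leNgt emission_time_lt // ltnn.
Qed.

Variables (n M : nat).
Hypothesis Z_sources : forall z, (z \in Z) = in_sources M z.

Lemma in_sources_mono M1 M2 z : (M1 <= M2)%N -> @in_sources d M1 z -> in_sources M2 z.
Proof.
move=> M12 /forallP zM1; apply/forallP => i; apply/implyP => /(implyP (zM1 i)) h.
by apply: le_trans h _; rewrite lez_nat.
Qed.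

(** A strictly sorted list is determined by its members, so [xget] can return only this one. The
    absence of points at time n reconciles [0, n] with the half-open bins. *)
Lemma emissions_particles h M' : (M' <= M)%N -> valid h -> matches_counts h ->
  (size h)%:R * delta = n%:R -> {in Z, forall z, ~ X z n%:R} ->
  emissions t n M' = [seq p <- rev (particles h) | in_sources M' p.1].
Proof.
move=> M'M vh m hn nX; set L := RHS.
have tr : transitive (fun p q : source d * nat => t p.1 p.2 < t q.1 q.2).
  by move=> ? ? ?; apply: lt_trans.
have Ls : sorted (fun p q => t p.1 p.2 < t q.1 q.2) L.
  by apply: sorted_filter => //; rewrite rev_sorted; apply: particles_sorted.
have Lm p : (p \in L) = in_sources M' p.1 && (0 <= t p.1 p.2 <= n%:R).
  rewrite mem_filter mem_rev mem_particles; case: (boolP (in_sources M' _)) => //= pM'.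
  have pZ : p.1 \in Z by rewrite Z_sources (in_sources_mono M'M).
  have [_ rt] := t_points pZ.
  have inX : X p.1 (t p.1 p.2) by rewrite -rt; exists p.2.
  have := X_half pZ inX; rewrite /half_line /= in_itv /= andbT => -> /=.
  rewrite -(emission_time_lt _ m pZ) hn lt_neqAle; case: eqP => // tn.
  by case: (nX _ pZ); rewrite -tn.
rewrite /emissions; apply: xget_unique; first by split.
move=> s [ss sm].
have irr : irreflexive (fun p q : source d * nat => t p.1 p.2 < t q.1 q.2).
  by move=> p; rewrite ltxx.
by apply: (irr_sorted_eq tr irr ss Ls) => p; rewrite Lm sm.
Qed.

End emission_times.

Section forest_of_history.
Variables (d T : nat) (W : source d -> nat -> nat -> site d).

Definition follows_labels (h : seq (letter d)) : Prop :=
  forall x, x \in numbered h -> forall k, (k <= T)%N ->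
    W x.1.1 x.1.2 k = traj (val x.1.1) x.2 k.

Definition truncate (z : source d) j k := W z j (minn k T).

Lemma forest_build keep h :
  all (fun a => if a is Some (_, om) then size om == T else true) h ->
  follows_labels h ->
  foldl (fun AG p => add_particle AG (truncate p.1 p.2)) (fset0, Graph fset0 fset0)
    [seq p <- rev (particles h) | keep p.1] = build keep h.
Proof.
elim: h => //= a h IH /andP[va vh] fl.
have fl' : follows_labels h.
  by move=> x xh; apply: fl; case: a {va} => [[z om]|] //=; rewrite inE xh orbT.
case: a va fl => [[z om]|] /= va fl; last exact: IH.
rewrite /particles /= rev_cons filter_rcons -/(particles h) /=.
case: (keep z); last exact: IH.
rewrite foldl_rcons (IH vh fl'); congr (add_particle _ _); apply/funext => k.
rewrite /truncate (fl ((z, emission_count z h), om)) ?geq_minr ?inE ?eqxx //=.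
by case: (leqP k T) => // Tk; rewrite /traj !take_oversize // (eqP va) // ltnW.
Qed.

End forest_of_history.

(** * Configurations *)

Section histories_seq.
Variables (d : nat) (Z : seq (source d)) (T : nat).
Hypothesis Z_uniq : uniq Z.

Lemma paths_uniq : uniq (paths d T).
Proof.
elim: T => //= T' IH; apply: allpairs_uniq => //; first exact: index_enum_uniq.
by move=> [e om] [e' om'] _ _ /= [-> ->].
Qed.

Lemma letters_uniq : uniq (letters Z T).
Proof.
rewrite /letters /=; apply/andP; split; first by apply/negP => /allpairsP[[? ?] []].
apply: allpairs_uniq => //; first exact: paths_uniq.
by move=> [z om] [z' om'] _ _ /= [-> ->].
Qed.

Lemma histories_uniq B : uniq (histories Z T B).
Proof.
elim: B => // B IH.
rewrite (_ : histories Z T B.+1 =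
  [seq a :: h | h <- histories Z T B, a <- letters Z T]) //.
apply: allpairs_uniq => //; first exact: letters_uniq.
by move=> [h a] [h' a'] _ _ /= [-> ->].
Qed.

Lemma mem_letters a : a \in letters Z T =
  if a is Some (z, om) then (z \in Z) && (size om == T) else true.
Proof.
rewrite /letters inE; case: a => [[z om]|] //=; rewrite -mem_paths.
apply/allpairsP/andP => [[[z' om'] /= [? ? [-> ->]]] //|[zZ omT]].
by exists (z, om).
Qed.

Lemma mem_histories B h :
  h \in histories Z T B = (size h == B) && all (mem (letters Z T)) h.
Proof.
elim: B h => [|B IH] h; first by rewrite inE; case: h.
rewrite (_ : histories Z T B.+1 =
  [seq a :: h | h <- histories Z T B, a <- letters Z T]) //.
apply/allpairsP/idP => [[[h' a] /= [+ aL ->]]|].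
  by rewrite IH /= eqSS => /andP[-> ->]; rewrite aL.
case: h => // a h; rewrite [size _]/= eqSS /= => /and3P[sz aL hL].
by exists (h, a); split => //=; rewrite IH sz.
Qed.

End histories_seq.

Section configuration.
Context {R : realType} {disp : measure_display} {Omega : measurableType disp}.
Variables (P : probability Omega R) (d : nat).
Variables (N : source d -> Omega -> set R) (tau : source d -> nat -> Omega -> R).
Variable W : source d -> nat -> nat -> Omega -> site d.
Hypothesis inputs : random_inputs P N tau W.
Variables (Z : seq (source d)) (T : nat) (delta : R).
Hypothesis Z_uniq : uniq Z.
Hypothesis delta_gt0 : 0 < delta.

Let N_poisson z : poisson_process P 1 (N z). Proof. by case: inputs. Qed.
Let W_walk z j : simple_random_walk P (val z) (W z j). Proof. by case: inputs. Qed.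

Definition counts_event h z : set Omega :=
  bin_counts delta (N z) (size h) (fun i => emits (nth None (rev h) i) z).

Definition configuration h : set Omega :=
  [set w | (forall z, z \in Z -> counts_event h z w) /\
    forall x, x \in numbered h -> follows (val x.1.1) (W x.1.1 x.1.2) T x.2 w].

Lemma configuration_cons a h w : configuration (a :: h) w <->
  [/\ configuration h w,
      forall z, z \in Z -> npoints (N z) (bin delta (size h)) w = (emits a z)%:R%:E
    & if a is Some (z, om) then follows (val z) (W z (emission_count z h)) T om w else True].
Proof.
have cntE : (forall z, z \in Z -> counts_event (a :: h) z w) <->
    (forall z, z \in Z -> counts_event h z w) /\
    forall z, z \in Z -> npoints (N z) (bin delta (size h)) w = (emits a z)%:R%:E.
  exact: (@matches_counts_cons _ _ (fun z => N z w) delta Z a h).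
split=> [[/cntE[cnt cnta] fl]|[[cnt fl] cnta fla]].
  split=> //.
    split=> // x xh; apply: fl; case: a {cntE cnta} => [[z om]|] //=.
    by rewrite inE xh orbT.
  case: a {cntE cnta} fl => [[z om]|] //= fl.
  by apply: (fl ((z, emission_count z h), om)); rewrite inE eqxx.
split; first exact/cntE.
case: a {cntE cnta} fla => [[z om]|] //= fla x.
by rewrite inE => /predU1P[->//|/fl].
Qed.

(** The counts determine which source, if any, emits in each bin. Equal pasts give the new particle
    the same index, hence the same walk, whose first T steps are then read off. *)
Lemma configuration_inj h h' w B : h \in histories Z T B -> h' \in histories Z T B ->
  configuration h w -> configuration h' w -> h = h'.
Proof.
rewrite !mem_histories => /andP[/eqP + +] /andP[/eqP + +].
elim: h h' B => [|a h IH] [|a' h'] [|B] //=.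
move=> [sh] /andP[aL hL] [sh'] /andP[a'L h'L].
move=> /configuration_cons[ch ca fa] /configuration_cons[ch' ca' fa'].
have hh' : h = h' by apply: (IH _ B).
rewrite -hh' in ca' fa' *; congr cons.
have em z : z \in Z -> emits a z = emits a' z.
  move=> zZ; have := ca z zZ; rewrite ca' // => -[] /eqP; rewrite eqr_nat.
  by case: (emits a z); case: (emits a' z).
move: aL a'L; rewrite !mem_letters.
case: a em fa {ca} => [[z om]|] em fa; case: a' em fa' {ca'} => [[z' om']|] em fa' //=.
- move=> /andP[zZ /eqP so] /andP[z'Z /eqP so'].
  have /eqP zz' : z' == z by rewrite -[_ == _]em //= eqxx.
  rewrite zz' in fa' *; congr (Some (_, _)).
  apply: (@traj_inj _ om om' (val z)); first by rewrite so so'.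
  by move=> k; rewrite so => kT; rewrite -fa // -fa'.
- by move=> /andP[zZ _] _; have := em _ zZ; rewrite /= eqxx.
- by move=> _ /andP[zZ _]; have := em _ zZ; rewrite /= eqxx.
Qed.

(** One index per process and per emitted particle, without repetition: the configuration becomes an
    intersection to which mutual independence applies. *)
Let keys h : seq (source d + source d * nat) := map inl Z ++ map inr (particles h).
Let event h (i : source d + source d * nat) : set Omega :=
  match i with
  | inl z => counts_event h z
  | inr p => follows (val p.1) (W p.1 p.2) T (label h p)
  end.

Let configurationE h : configuration h = \bigcap_(i in [set` keys h]) event h i.
Proof.
apply/seteqP; split=> w.
- move=> [cnt fl] i /=; rewrite mem_cat => /orP[] /mapP[y yin ->] /=; first exact: cnt.
  exact: (fl _ (particle_label yin)).
- move=> cap; split=> [z zZ|x xh].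
    by apply: (cap (inl z)); rewrite /= mem_cat map_f.
  rewrite -(label_numbered xh); apply: (cap (inr x.1)).
  by rewrite /= mem_cat map_f ?orbT // map_f.
Qed.

Lemma configuration_measurable h : measurable (configuration h).
Proof.
rewrite configurationE; apply: fin_bigcap_measurable; first exact: finite_seq.
move=> [z|p] _ /=.
- exact: (bin_counts_measurable delta_gt0 (N_poisson z)).
- exact: (follows_measurable (W_walk p.1 p.2)).
Qed.

Definition no_emission_weight : R := expR (- delta) ^+ size Z.
Definition emission_weight : R := no_emission_weight * delta / ((2 * d) ^ T)%:R.

Lemma configuration_prob h B : h \in histories Z T B ->
  P (configuration h) = (weight no_emission_weight emission_weight h)%:E.
Proof.
rewrite mem_histories => /andP[_ /allP hL0].
have {hL0}hL a : a \in h -> a \in letters Z T by move=> /hL0.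
pose p (i : source d + source d * nat) : R := match i with
  | inl z => \prod_(a <- h) (expR (- delta) * delta ^+ emits a z)
  | inr _ => (((2 * d) ^ T)%:R)^-1 end.
have [_ _ _ indep] := inputs.
rewrite configurationE (mutually_independent_seq (p := p) indep).
(* Exchanging the products over sources and bins turns each bin into one factor, the weight of its
   letter. *)
- congr _%:E; rewrite /keys big_cat !big_map /= exchange_big /=.
  have -> : \prod_(j <- numbered h) (((2 * d) ^ T)%:R)^-1 =
      \prod_(a <- h) (if a is Some _ then (((2 * d) ^ T)%:R)^-1 else 1) :> R.
    elim: (h) => [|[[z om]|] h' IH].
    + by rewrite !big_nil.
    + by rewrite /= !big_cons IH.
    + by rewrite /= big_cons mul1r IH.
  rewrite -big_split /= /weight; apply: eq_big_seq => a /hL.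
  rewrite mem_letters big_split /=.
  have -> : \prod_(z <- Z) expR (- delta) = no_emission_weight.
    by rewrite big_const_seq count_predT /no_emission_weight; elim: (size Z) => //= k ->; rewrite exprS.
  case: a => [[z om]|] /=; last by rewrite big1 // !mulr1.
  case/andP=> zZ _; rewrite (bigD1_seq z) //= eqxx expr1 big1 ?mulr1 //.
  by move=> z' zz'; rewrite eq_sym (negbTE zz') expr0.
- rewrite cat_uniq; apply/and3P; split.
  + by rewrite map_inj_uniq // => ? ? [].
  + by apply/hasPn => _ /mapP[x _ ->]; apply/negP => /mapP[].
  + by rewrite map_inj_uniq ?particles_uniq // => ? ? [].
- move=> i; rewrite mem_cat => /orP[] /mapP[y yin ->] /=.
  + exact: bin_counts_sigma.
  + by case: y yin => z j _; apply: follows_sigma.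
- move=> i; rewrite mem_cat => /orP[] /mapP[y yin ->] /=.
  + rewrite /counts_event (bin_counts_prob delta_gt0 (N_poisson y)); congr _%:E.
    rewrite -(big_mkord xpredT (fun i => expR (- delta) * delta ^+ emits (nth None (rev h) i) y)).
    rewrite -[size h]size_rev -(big_nth None xpredT (fun a => expR (- delta) * delta ^+ emits a y)).
    by apply: perm_big; rewrite perm_rev.
  + apply: (follows_prob (W_walk y.1 y.2)).
    have /numbered_mem /hL := particle_label yin.
    by rewrite mem_letters mem_paths => /andP[].
Qed.

Lemma configurations_prob B (b : pred (seq (letter d))) :
  let E := \bigcup_(h in [set` [seq h <- histories Z T B | b h]]) configuration h in
  measurable E /\
  P E = (mean Z T no_emission_weight emission_weight B (fun h => (b h)%:R))%:E.
Proof.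
move=> E; have fin : finite_set [set` [seq h <- histories Z T B | b h]] by exact: finite_seq.
split; first by apply: fin_bigcup_measurable => // h _; apply: configuration_measurable.
rewrite /E measure_fin_bigcup //.
- rewrite -fsbig_seq ?filter_uniq ?histories_uniq //.
  rewrite (eq_big_seq (fun h => (weight no_emission_weight emission_weight h)%:E)); last first.
    by move=> h; rewrite mem_filter => /andP[_ hB]; apply: configuration_prob hB.
  rewrite sumEFin; congr _%:E; rewrite /mean big_filter big_mkcond /=.
  by apply: eq_bigr => h _; case: (b h); rewrite ?mulr1 ?mulr0.
- move=> h h' /=; rewrite !mem_filter => /andP[_ hB] /andP[_ h'B] [w [cw cw']].
  exact: configuration_inj hB h'B cw cw'.
- by move=> h _; apply: configuration_measurable.
Qed.

End configuration.

(** * One more layer of sources *)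

Section sources.
Variables (d M : nat).

(** All d coordinates range over {-M, ..., M}; [insub] then keeps the sources. The resulting count
    (2M+1)^d is enough here. *)
Let box_site (f : {ffun 'I_d -> 'I_(M.*2.+1)}) : site d :=
  \row_i ((f i)%:Z - M%:Z).

Definition sources : seq (source d) :=
  [seq z <- undup (pmap insub [seq box_site f | f : {ffun 'I_d -> 'I_(M.*2.+1)}]) |
    in_sources M z].

Lemma sources_uniq : uniq sources.
Proof. by rewrite filter_uniq // undup_uniq. Qed.

Lemma size_sources : (size sources <= M.*2.+1 ^ d)%N.
Proof.
rewrite size_filter (leq_trans (count_size _ _)) // (leq_trans (size_undup _)) //.
rewrite size_pmap (leq_trans (count_size _ _)) // size_map.
by rewrite -cardE card_ffun !card_ord.
Qed.

Lemma mem_sources z : (z \in sources) = in_sources M z.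
Proof.
rewrite mem_filter mem_undup; case: (boolP (in_sources M z)) => //= zM.
rewrite mem_pmap; apply/mapP; exists (val z); last by rewrite valK.
pose f : {ffun 'I_d -> 'I_(M.*2.+1)} := [ffun i => inord (absz (val z ord0 i + M%:Z))].
suff -> : val z = box_site f by apply/mapP; exists f; rewrite // mem_enum.
apply/rowP => i; rewrite mxE ffunE.
have zi : `|val z ord0 i| <= M%:Z.
  have [i0|i0] := eqVneq (i : nat) 0%N.
    by move/forallP: (valP z) => /(_ i); rewrite i0 eqxx => /eqP ->; rewrite normr0.
  by move/forallP: zM => /(_ i); rewrite i0.
have -> : val (inord (absz (val z ord0 i + M%:Z)) : 'I_(M.*2.+1)) = absz (val z ord0 i + M%:Z).
  by rewrite /= inordK //; move: zi; move: (val z ord0 i) => c; lia.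
by move: zi; move: (val z ord0 i) => c; lia.
Qed.

End sources.

(** * Outer probability bounds and Borel-Cantelli *)

Section outer.
Context {R : realType} {disp : measure_display} {Omega : measurableType disp}.
Variable P : probability Omega R.

(* The times [tau] list the points of [N] only almost surely, so events defined
   through the forests need not be measurable. *)
Definition outer_le (A : set Omega) (e : R) : Prop :=
  exists E, [/\ measurable E, A `<=` E & (P E <= e%:E)%E].

Lemma outer_le_sub A A' e : A `<=` A' -> outer_le A' e -> outer_le A e.
Proof. by move=> AA' [E [mE A'E PE]]; exists E; split=> // w /AA' /A'E. Qed.

Lemma outer_le_mono A e e' : e <= e' -> outer_le A e -> outer_le A e'.
Proof. by move=> ee' [E [mE AE PE]]; exists E; split=> //; apply: le_trans PE _; rewrite lee_fin. Qed.

Lemma outer_leU A A' e e' : outer_le A e -> outer_le A' e' -> outer_le (A `|` A') (e + e').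
Proof.
move=> [E [mE AE PE]] [E' [mE' AE' PE']]; exists (E `|` E'); split.
- exact: measurableU.
- by apply: setUSS.
- by rewrite (le_trans (measureU2 _ _ _)) // EFinD leeD.
Qed.

Lemma outer_le_negligible A : P.-negligible A -> outer_le A 0.
Proof. by move=> [E [mE PE AE]]; exists E; split=> //; rewrite PE. Qed.

(** Continuity from below along the increasing intersections of measurable covers. It serves to let
    the stopping time T of the walks tend to infinity. *)
Lemma outer_le_liminf (A : nat -> set Omega) e : (forall T, outer_le (A T) e) ->
  outer_le (\bigcup_T0 \bigcap_(T in [set T | (T0 <= T)%N]) A T) e.
Proof.
move=> /choice[E EP]; pose G T0 := \bigcap_(T in [set T | (T0 <= T)%N]) E T.
have mG T0 : measurable (G T0).
  by apply: bigcap_measurable; [exists T0 => /=|move=> T _; case: (EP T)].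
have mUG : measurable (\bigcup_T0 G T0) by exact: bigcup_measurable.
exists (\bigcup_T0 G T0); split=> //.
  by apply: subset_bigcup => T0 _; apply: subset_bigcap => T _; case: (EP T).
have Gnd : {homo G : n m / (n <= m)%N >-> (n <= m)%O}.
  move=> n m nm; apply/subsetPset => w Gw T /= mT; apply: Gw => /=; exact: leq_trans mT.
have cv := nondecreasing_cvg_mu (mu := P) mG mUG Gnd.
rewrite -(cvg_lim _ cv) //; apply: lime_le; first by apply/cvg_ex; eexists; exact: cv.
apply: nearW => T /=; have [mE _ PE] := EP T; apply: le_trans PE.
by apply: le_measure; rewrite ?inE //; apply: bigcap_inf => /=.
Qed.

Lemma borel_cantelli (A : nat -> set Omega) (e : nat -> R) (b : R) :
  (forall k, outer_le (A k) (e k)) -> (forall k, 0 <= e k) ->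
  (forall m, \sum_(k < m) e k <= b) ->
  {ae P, forall w, exists k0, forall k, (k0 <= k)%N -> ~ A k w}.
Proof.
move=> /choice[E EP] e0 eb.
have mE k : measurable (E k) by case: (EP k).
have mL : measurable (lim_sup_set E).
  apply: bigcapT_measurable => k; apply: bigcup_measurable => j _; exact: mE.
exists (lim_sup_set E); split=> //.
  apply: lim_sup_set_cvg0 => //.
  apply: (@le_lt_trans _ _ b%:E); last by rewrite ltry.
  apply: lime_le; first by apply: is_cvg_nneseries.
  apply: nearW => m; rewrite big_mkord.
  apply: (@le_trans _ _ (\sum_(k < m) (e k)%:E)%E).
    by apply: lee_sum => k _; case: (EP k).
  by rewrite sumEFin lee_fin.
move=> w /= nA k _; apply: contrapT => nE; apply: nA; exists k => j kj Aj.
by apply: nE; exists j => //; case: (EP j) => _ /(_ _ Aj).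
Qed.

End outer.

(** * Walks stopped after T steps *)

Section truncation.
Variable d : nat.

(** The exit index serves as [T0]. If the walk never leaves A, neither does any stopped version of
    it. *)
Lemma add_particle_truncate (AG : {fset site d} * graph d) s :
  exists T0, forall T, (T0 <= T)%N ->
    add_particle AG (fun k => s (minn k T)) = add_particle AG s.
Proof.
case: AG => A [V E]; case Es: (exit_index A s) => [k|].
  exists k => T kT; rewrite /add_particle Es.
  have [kA kmin] := (exit_index_SomeP _ _ _).1 Es.
  suff -> : exit_index A (fun j => s (minn j T)) = Some k.
    case: k kT {Es kA kmin} => [|k] kT; first by rewrite min0n.
    by rewrite !(minn_idPl _) // ltnW.
  apply/exit_index_SomeP; rewrite (minn_idPl kT); split=> // i ik.
  by rewrite (minn_idPl _) ?kmin // (leq_trans (ltnW ik)).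
exists 0%N => T _; rewrite /add_particle Es.
suff -> : exit_index A (fun j => s (minn j T)) = None by [].
by apply/exit_index_NoneP => j; move/exit_index_NoneP: Es; apply.
Qed.

Lemma foldl_truncate (W : source d -> nat -> nat -> site d) (L : seq (source d * nat)) AG :
  exists T0, forall T, (T0 <= T)%N ->
    foldl (fun AG p => add_particle AG (truncate T W p.1 p.2)) AG L =
    foldl (fun AG p => add_particle AG (W p.1 p.2)) AG L.
Proof.
elim: L AG => [|p L IH] AG /=; first by exists 0%N.
have [T1 T1P] := add_particle_truncate AG (W p.1 p.2).
have [T2 T2P] := IH (add_particle AG (W p.1 p.2)).
exists (maxn T1 T2) => T; rewrite geq_max => /andP[T1T T2T].
by rewrite -[RHS](T2P T T2T) -(T1P T T1T).
Qed.

Lemma forest_truncate (R : realType) (t : source d -> nat -> R) W n M :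
  exists T0, forall T, (T0 <= T)%N -> forest t (truncate T W) n M = forest t W n M.
Proof.
rewrite /forest /aggregate_forest; move: (emissions t n M) (fset0, _) => L AG.
have [T0 T0P] := foldl_truncate W L AG.
by exists T0 => T TT0; exact: (f_equal snd (T0P T TT0)).
Qed.

End truncation.

(** * Comparison of the forests built from H_M and H_(M+1) *)

Section one_step.
Context {R : realType} {disp : measure_display} {Omega : measurableType disp}.
Variables (P : probability Omega R) (d : nat).
Variables (N : source d.+1 -> Omega -> set R) (tau : source d.+1 -> nat -> Omega -> R).
Variable W : source d.+1 -> nat -> nat -> Omega -> site d.+1.
Hypothesis inputs : random_inputs P N tau W.
Variables (n K : nat).
Hypothesis n_gt0 : (0 < n)%N.

Let F w M := forest (fun z j => tau z j w) (fun z j k => W z j k w) n M.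
Let FT T w M := forest (fun z j => tau z j w) (truncate T (fun z j k => W z j k w)) n M.

Let null_set M : set Omega := [set w | exists2 z, z \in sources d.+1 M &
  ~ successive_points (N z w) (tau z ^~ w) \/ N z w n%:R].

(** A single time has Lebesgue measure 0, so its count is Poisson of parameter 0, that is, almost
    surely 0. *)
Lemma fixed_time_negligible z t : half_line t -> P.-negligible [set w | N z w t].
Proof.
move=> t0; have [_ _ _ _] := inputs.
have /(_ z) [_ Nm Nlaw _] : forall z, poisson_process P 1 (N z) by case: inputs.
have mt : measurable [set t] by exact: measurable_set1.
have st : [set t] `<=` half_line by move=> _ ->.
have lt0 : lebesgue_measure [set t] = 0%E :> \bar R by exact: lebesgue_measure_set1.
have := Nlaw _ mt st; rewrite lt0 => /(_ (ltry _) 0%N).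
rewrite /poisson_prob /= mulr0 ltxx diracE mem_set //= => P0.
have m0 : measurable [set w | npoints (N z) [set t] w = 0%:E].
  have := Nm _ mt st measurableT [set 0%E] (emeasurable_set1 _).
  by rewrite setTI.
exists (~` [set w | npoints (N z) [set t] w = 0%:E]); split.
- exact: measurableC.
- by rewrite probability_setC // P0 subee.
- move=> w /= Nt c0; have := @counting_bool R _ (N z w `&` [set t]) false c0.
  by move=> /seteqP[/(_ t) h _]; apply: h.
Qed.

Lemma null_set_negligible M : P.-negligible (null_set M).
Proof.
have [_ pts _ _] := inputs.
have neg z : P.-negligible ([set w | ~ successive_points (N z w) (tau z ^~ w)] `|` [set w | N z w n%:R]).
  apply: negligibleU; first exact: pts.
  by apply: fixed_time_negligible; rewrite /half_line /= in_itv /= andbT.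
rewrite (_ : null_set M = \big[setU/set0]_(z <- sources d.+1 M)
  ([set w | ~ successive_points (N z w) (tau z ^~ w)] `|` [set w | N z w n%:R])).
  by apply: big_ind => //; [exact: negligible_set0|exact: negligibleU].
rewrite -bigcup_seq; apply/seteqP; split=> w /=.
  by move=> [z zs h]; exists z.
by move=> [z zs h]; exists z.
Qed.

Section fixed.
Variables (M B T H : nat).
Hypothesis B_gt0 : (0 < B)%N.
Hypothesis H_gt0 : (0 < H)%N.

Let delta : R := n%:R / B%:R.
Let Z := sources d.+1 M.+1.
Let keep := [pred z : source d.+1 | in_sources M z].

Let delta_gt0 : 0 < delta. Proof. by rewrite divr_gt0 ?ltr0n. Qed.
Let deltaB : B%:R * delta = n%:R.
Proof. by rewrite /delta mulrC divfK // pnatr_eq0 -lt0n. Qed.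

Lemma truncated_discrepancy h w : h \in histories Z T B ->
  configuration N W Z T delta h w -> ~ null_set M.+1 w ->
  restrict_strip K (FT T w M.+1) <> restrict_strip K (FT T w M) ->
  ever_discrepancy K keep h.
Proof.
rewrite mem_histories => /andP[/eqP szh /allP hL] [cnt fl] nw.
apply: contra_notT => nd.
have Npts : {in Z, forall z, successive_points (N z w) (tau z ^~ w)}.
  by move=> z zZ; apply: contrapT => h'; apply: nw; exists z => //; left.
have Nhalf : {in Z, forall z, N z w `<=` half_line}.
  by move=> z _; have [/(_ z) [h' _ _ _] _ _ _] := inputs.
have Nn : {in Z, forall z, ~ N z w n%:R}.
  by move=> z zZ h'; apply: nw; exists z => //; right.
have vh : all (fun a : letter d.+1 => if a is Some (z, _) then z \in Z else true) h.
  by apply/allP => a /hL; rewrite /= mem_letters; case: a => [[z om]|] // /andP[].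
have vT : all (fun a : letter d.+1 => if a is Some (_, om) then size om == T else true) h.
  by apply/allP => a /hL; rewrite /= mem_letters; case: a => [[z om]|] // /andP[].
have em M' : (M' <= M.+1)%N -> emissions (fun z j => tau z j w) n M' =
    [seq p <- rev (particles h) | in_sources M' p.1].
  move=> M'M; apply: (emissions_particles delta_gt0 Npts Nhalf (mem_sources M.+1) M'M vh) => //.
  by rewrite szh deltaB.
have FTE M' : (M' <= M.+1)%N ->
    FT T w M' = (build [pred z : source d.+1 | in_sources M' z] h).2.
  move=> M'M; rewrite /FT /forest /aggregate_forest em //.
  by rewrite (forest_build [pred z : source d.+1 | in_sources M' z] vT).
rewrite !FTE // (restrict_strip_build nd); congr restrict_strip; congr snd.
(* All sources of the history lie in H_(M+1), so keeping those is keeping every source. *)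
elim: (h) vh => //= a h' IH /andP[va /IH ->]; case: a va => [[z om]|] //=.
by rewrite mem_sources => ->.
Qed.

Lemma truncated_bound : outer_le P
  [set w | restrict_strip K (FT T w M.+1) <> restrict_strip K (FT T w M)]
  ((size Z)%:R * expR n%:R * 2 ^- H +
   n%:R * (size Z)%:R * (2 * decay R d H ^+ M.+1 / decay R d H ^+ (d * K)) +
   (n%:R * (size Z)%:R) ^+ 2 / B%:R).
Proof.
set p0 := no_emission_weight Z delta; set p1 := emission_weight Z T delta.
have uZ : uniq Z by exact: sources_uniq.
have [mE PE] := configurations_prob inputs T uZ delta_gt0 B (ever_discrepancy K keep).
have [mC PC] := configurations_prob inputs T uZ delta_gt0 B xpredT.
set E := \bigcup_(h in _) _ in mE PE; set C := \bigcup_(h in _) _ in mC PC.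
have p0_ge0 : 0 <= p0 by rewrite exprn_ge0 ?expR_ge0.
have p1_ge0 : 0 <= p1 by rewrite divr_ge0 ?ler0n // mulr_ge0 // ltW.
pose y : R := delta * (size Z)%:R.
have y_ge0 : 0 <= y by rewrite mulr_ge0 ?ler0n // ltW.
have p0E : p0 = expR (- y).
  by rewrite /p0 /no_emission_weight -expRM_natl /y mulrN mulrC.
have rateE : p1 * ((2 * d.+1) ^ T)%:R = p0 * delta.
  by rewrite /p1 /emission_weight divfK // pnatr_eq0 expn_eq0.
have total_le1 : p0 + p0 * delta * (size Z)%:R <= 1.
  rewrite -mulrA -/y -[X in X + _]mulr1 -mulrDr p0E expRN ler_pdivrMl ?expR_gt0 // mulr1.
  exact: expR_ge1Dx.
have p0_le1 : p0 <= 1 by rewrite p0E -expR0 ler_expR oppr_le0.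
have rate_le : p0 * delta <= delta by rewrite ler_piMl // ltW.
have rate_ge0 : 0 <= p0 * delta by rewrite mulr_ge0 // ltW.
have q0 := decay_gt0 R d H_gt0.
(* Outside the null set, a difference in the strip comes either from a history with a discrepancy or
   from an outcome that no history describes. *)
apply: (@outer_le_sub _ _ _ _ _ ((E `|` ~` C) `|` null_set M.+1)).
  move=> w /= bad; have [nw|nw] := pselect (null_set M.+1 w); [by right|left].
  have [[h hC ch]|nC] := pselect (C w); last by right.
  move: hC; rewrite /= mem_filter /= => hB.
  left; exists h => //; rewrite /= mem_filter hB andbT.
  exact: (truncated_discrepancy hB ch nw bad).
rewrite -[X in outer_le _ _ X]addr0; apply: outer_leU; last first.
  by apply: outer_le_negligible; apply: null_set_negligible.
apply: outer_leU.
  exists E; split=> //; rewrite PE lee_fin.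
  have tot : p0 + p1 * ((2 * d.+1) ^ T)%:R * (size Z)%:R <= 1 by rewrite rateE.
  apply: (le_trans (mean_ever_discrepancy uZ p0_ge0 p1_ge0 tot K M H_gt0 B)).
  rewrite rateE; apply: lerD.
    rewrite ler_wpM2r ?invr_ge0 ?exprn_ge0 // ler_wpM2l ?ler0n //.
    apply: (@le_trans _ _ ((1 + delta) ^+ B)).
      by rewrite lerXn2r ?nnegrE ?lerD2l // addr_ge0 // ltW.
    rewrite -deltaB mulr_natl -mulr_natr mulrC expRM_natl.
    by rewrite lerXn2r ?nnegrE ?expR_ge0 ?expR_ge1Dx // addr_ge0 // ltW.
  rewrite ler_wpM2r ?divr_ge0 ?mulr_ge0 ?exprn_ge0 ?(ltW q0) //.
  by rewrite ler_wpM2r ?ler0n // -deltaB ler_wpM2l ?ler0n.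
exists (~` C); split=> //; first exact: measurableC.
rewrite probability_setC // PC -EFinB lee_fin mean_cst rateE mulr1.
set t := p0 + _ in total_le1 *.
have t_ge0 : 0 <= t by rewrite addr_ge0 // mulr_ge0 ?ler0n.
(* Here t = exp(-y)(1 + y) is the total weight of one bin and 1 - t^B the probability that no
   history matches. As exp(-y) >= 1 - y, it is at most B y^2, of order 1/B. *)
have bern : 1 - t ^+ B <= B%:R * (1 - t).
  elim: (B) => [|b IH]; first by rewrite expr0 subrr mul0r.
  have tb : 0 <= t ^+ b <= 1 by rewrite exprn_ge0 //= exprn_ile1.
  have := IH; rewrite exprS -natr1; nra.
have t_ge : 1 - y ^+ 2 <= t.
  have -> : t = p0 * (1 + y) by rewrite /t /y; ring.
  by rewrite p0E; have := expR_ge1Dx (- y); nra.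
apply: (le_trans bern); apply: (@le_trans _ _ (B%:R * y ^+ 2)).
  by rewrite ler_wpM2l ?ler0n //; lra.
have B0 : B%:R != 0 :> R by rewrite pnatr_eq0 -lt0n.
by rewrite le_eqVlt /y /delta; apply/predU1P; left; field.
Qed.

End fixed.

(** The bound for stopped walks does not depend on T, and each outcome gives the same forests for
    all large T, so the bad event lies in the lower limit of the stopped ones. *)
Lemma step_bound M B H : (0 < B)%N -> (0 < H)%N -> outer_le P
  [set w | restrict_strip K (F w M.+1) <> restrict_strip K (F w M)]
  ((size (sources d.+1 M.+1))%:R * expR n%:R * 2 ^- H +
   n%:R * (size (sources d.+1 M.+1))%:R *
     (2 * decay R d H ^+ M.+1 / decay R d H ^+ (d * K)) +
   (n%:R * (size (sources d.+1 M.+1))%:R) ^+ 2 / B%:R).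
Proof.
move=> B0 H0; apply: outer_le_sub (outer_le_liminf (fun T => truncated_bound M T B0 H0)).
move=> w bad.
have [T1 T1P] := forest_truncate (fun z j => tau z j w) (fun z j k => W z j k w) n M.+1.
have [T2 T2P] := forest_truncate (fun z j => tau z j w) (fun z j k => W z j k w) n M.
exists (maxn T1 T2); first by [].
move=> T; rewrite [X in X -> _]/= geq_max => /andP[T1T T2T].
by rewrite /FT /= (T1P _ T1T) (T2P _ T2T); exact: bad.
Qed.

End one_step.

(** * Rates *)

Section rates.
Variable R : realType.

Lemma expRN_le (x : R) a : 0 < x -> expR (- x) <= a`!%:R / x ^+ a.
Proof.
move=> x0; rewrite ler_pdivlMr ?exprn_gt0 // expRN ler_pdivrMl ?expR_gt0 //.
case: a => [|a].
  by rewrite expr0 fact0 mulr1; have := expR_ge1Dx x; lra.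
have := expR_ge1Dxn a (ltW x0) => h.
have f0 : 0 < (a.+1)`!%:R :> R by rewrite ltr0n fact_gt0.
rewrite -ler_pdivrMr //; apply: le_trans h; by rewrite lerDr.
Qed.

Lemma exists_sqrt m : (0 < m)%N -> exists2 H, (0 < H)%N & (H ^ 2 <= m < H.+1 ^ 2)%N.
Proof.
elim: m => // -[_ _|m IH _]; first by exists 1%N.
have [H H0 /andP[H1 H2]] := IH isT.
case: (ltnP m.+2 (H.+1 ^ 2)%N) => h.
  by exists H => //; rewrite h (leq_trans H1).
by exists H.+1 => //; rewrite h; nia.
Qed.

(** Exponential decay in H, which is of order sqrt m, beats any power of m: exp(-x) <= (2D)!/x^(2D)
    with x = H/b, and m <= 4 H^2. *)
Lemma expRN_sqrt_le (m H D b : nat) : (0 < b)%N -> (0 < H)%N -> (m < H.+1 ^ 2)%N ->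
  m%:R ^+ D * expR (- (H%:R / b%:R)) <= (D.*2)`!%:R * (4 * b%:R ^+ 2) ^+ D :> R.
Proof.
move=> b0 H0 mH.
have bR : 0 < b%:R :> R by rewrite ltr0n.
have HR : 0 < H%:R :> R by rewrite ltr0n.
apply: (@le_trans _ _ (m%:R ^+ D * ((D.*2)`!%:R / (H%:R / b%:R) ^+ D.*2))).
  by rewrite ler_wpM2l ?exprn_ge0 ?ler0n // expRN_le // divr_gt0.
rewrite mulrCA ler_wpM2l ?ler0n // ler_pdivrMr ?exprn_gt0 ?divr_gt0 //.
rewrite -mul2n exprM -exprMn.
have -> : 4 * b%:R ^+ 2 * (H%:R / b%:R) ^+ 2 = (4 * H ^ 2)%:R :> R.
  by rewrite natrM natrX; field; rewrite gt_eqF.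
by rewrite lerXn2r ?nnegrE ?ler0n // ler_nat; nia.
Qed.

Lemma sum_inv_square_le m : \sum_(k < m) ((k.+1)%:R ^+ 2)^-1 <= 2 :> R.
Proof.
(* The bound is strengthened so that the induction closes by telescoping. *)
suff h : forall m, \sum_(k < m.+1) ((k.+1)%:R ^+ 2)^-1 <= 2 - (m.+1)%:R^-1 :> R.
  case: m => [|m]; first by rewrite big_ord0.
  by apply: (le_trans (h m)); rewrite gerBl invr_ge0.
elim=> [|k IH]; first by rewrite big_ord_recr big_ord0 /= expr1n invr1; lra.
rewrite big_ord_recr /=; apply: (le_trans (lerD IH (lexx _))).
set u : R := k.+1%:R; have u0 : 0 < u by rewrite ltr0n.
have -> : k.+2%:R = u + 1 by rewrite /u -natr1.
rewrite -subr_ge0.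
have -> : 2 - (u + 1)^-1 - (2 - u^-1 + ((u + 1) ^+ 2)^-1) = (u * (u + 1) ^+ 2)^-1.
  by field; rewrite !gt_eqF //; lra.
by rewrite invr_ge0 mulr_ge0 ?exprn_ge0 //; lra.
Qed.

Lemma step_bound_summable (d n K : nat) : exists C : R, 0 <= C /\
  forall M, exists B H, [/\ (0 < B)%N, (0 < H)%N &
  (size (sources d.+1 M.+1))%:R * expR n%:R * 2 ^- H +
  n%:R * (size (sources d.+1 M.+1))%:R *
     (2 * decay R d H ^+ M.+1 / decay R d H ^+ (d * K)) +
  (n%:R * (size (sources d.+1 M.+1))%:R) ^+ 2 / B%:R <= C * (M.+1%:R ^+ 2)^-1].
Proof.
(* With m = M + 1 there are at most (2m+1)^(d+1) <= (3m)^(d+1) sources; the two further powers in D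
   yield the summable factor m^-2. *)
pose D := d.+3; pose c b : R := (D.*2)`!%:R * (4 * b%:R ^+ 2) ^+ D.
have c0 b : 0 <= c b by rewrite /c mulr_ge0 ?ler0n // exprn_ge0 // mulr_ge0 ?exprn_ge0 ?ler0n.
pose C1 := 3 ^+ d.+1 * expR n%:R * c 2%N.
pose C2 := n%:R * 3 ^+ d.+1 * (2 * 2 ^+ (d * K)) * c (2 * d.+1)%N.
have C10 : 0 <= C1 by rewrite mulr_ge0 ?c0 // mulr_ge0 ?expR_ge0 ?exprn_ge0.
have C20 : 0 <= C2 by rewrite mulr_ge0 ?c0 // !mulr_ge0 ?exprn_ge0 ?ler0n.
exists (C1 + C2 + 1); split; first by rewrite !addr_ge0 ?ler01.
move=> M; pose m := M.+1; have [H H0 /andP[Hm mH]] := @exists_sqrt m isT.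
set s : R := (size _)%:R; have s0 : 0 <= s by rewrite ler0n.
have m0 : 0 < m%:R :> R by rewrite ltr0n.
have s_le : s <= 3 ^+ d.+1 * m%:R ^+ d.+1.
  rewrite -exprMn -natrM -natrX ler_nat (leq_trans (size_sources _ _)) //.
  by rewrite leq_exp2r // /m; lia.
(* This number of bins makes the last term at most m^-2, while H is the integer part of sqrt m. *)
exists ((n * size (sources d.+1 M.+1) * m) ^ 2).+1, H; split => //.
have q0 := decay_gt0 R d H0.
have qE : decay R d H = 1 - ((2 * d.+1)%:R * H%:R)^-1 by rewrite /decay -natrM.
have q_half : 2^-1 <= decay R d H.
  have : ((2 * d.+1)%:R * H%:R)^-1 <= 2^-1 :> R.
    have h2 : (2 <= 2 * d.+1 * H)%N by rewrite -mulnA leq_pmulr // muln_gt0.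
    by rewrite -natrM lef_pV2 ?posrE ?ltr0n ?ler_nat // (leq_trans _ h2).
  by rewrite qE; move: (_^-1) => e; lra.
have b0 : (0 < 2 * d.+1)%N by [].
have t1 : m%:R ^+ D * 2 ^- H <= c 2%N.
  apply: le_trans (expRN_sqrt_le D (isT : 0 < 2)%N H0 mH).
  rewrite ler_wpM2l ?exprn_ge0 ?(ltW m0) // -exprVn -mulrN expRM_natl
    lerXn2r ?nnegrE ?invr_ge0 ?expR_ge0 //.
  by have := expR_ge1Dx (- 2^-1 : R); lra.
have t2 : m%:R ^+ D * decay R d H ^+ m <= c (2 * d.+1)%N.
  apply: le_trans (expRN_sqrt_le D b0 H0 mH).
  rewrite ler_wpM2l ?exprn_ge0 ?(ltW m0) //.
  apply: (@le_trans _ _ (decay R d H ^+ (H ^ 2))).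
    by rewrite ler_wiXn2l ?(ltW q0) ?decay_le1.
  have -> : - (H%:R / (2 * d.+1)%:R) = (H ^ 2)%:R * - ((2 * d.+1)%:R * H%:R)^-1 :> R.
    rewrite natrX; field; rewrite pnatr_eq0 -lt0n H0 /=.
    by rewrite gt_eqF // -natrM ltr0n.
  rewrite expRM_natl lerXn2r ?nnegrE ?expR_ge0 ?(ltW q0) //.
  by rewrite qE; exact: expR_ge1Dx.
have m2 : 0 < m%:R ^+ 2 :> R by rewrite exprn_gt0.
have sm x : 0 <= x -> s * x * m%:R ^+ 2 <= 3 ^+ d.+1 * (m%:R ^+ D * x).
  move=> x0; have -> : 3 ^+ d.+1 * (m%:R ^+ D * x) = 3 ^+ d.+1 * m%:R ^+ d.+1 * x * m%:R ^+ 2 :> R.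
    by rewrite /D !exprS; ring.
  by rewrite ler_wpM2r ?(ltW m2) // ler_wpM2r.
rewrite -/m ler_pdivlMr // !mulrDl mul1r; apply: lerD; first apply: lerD.
- have -> : s * expR n%:R * 2 ^- H * m%:R ^+ 2 = expR n%:R * (s * 2 ^- H * m%:R ^+ 2) by ring.
  rewrite /C1 [leRHS](_ : _ = expR n%:R * (3 ^+ d.+1 * c 2%N)); last by ring.
  rewrite ler_wpM2l ?expR_ge0 // (le_trans (sm _ _)) ?invr_ge0 ?exprn_ge0 //.
  by rewrite ler_wpM2l ?exprn_ge0.
- have qK : (decay R d H ^+ (d * K))^-1 <= 2 ^+ (d * K).
    rewrite -exprVn lerXn2r ?nnegrE ?invr_ge0 ?(ltW q0) //.
    by rewrite -[leRHS]invrK lef_pV2 ?posrE ?invr_gt0.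
  set v := (_ ^+ (d * K))^-1 in qK *; have v0 : 0 <= v by rewrite invr_ge0 exprn_ge0 ?ltW.
  rewrite [leLHS](_ : _ = (n%:R * 2 * v) * (s * decay R d H ^+ m * m%:R ^+ 2)); last by ring.
  rewrite /C2 [leRHS](_ : _ = (n%:R * 2 * 2 ^+ (d * K)) * (3 ^+ d.+1 * c (2 * d.+1)%N)); last by ring.
  apply: ler_pM; rewrite ?mulr_ge0 ?ler0n ?exprn_ge0 ?(ltW q0) //.
    by rewrite ler_wpM2l ?mulr_ge0 ?ler0n.
  rewrite (le_trans (sm _ _)) ?exprn_ge0 ?(ltW q0) //.
  by rewrite ler_wpM2l ?exprn_ge0.
- rewrite mulrAC ler_pdivrMr ?ltr0n // mul1r -exprMn /s -!natrM -natrX ler_nat.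
  exact: leqnSn.
Qed.

End rates.

(** * Almost sure stabilisation in the strip *)

Theorem theorem1p1 (R : realType) (d : nat) (hd : (2 <= d)%N)
  (disp : measure_display) (Omega : measurableType disp)
  (P : probability Omega R)
  (N : source d -> Omega -> set R)
  (tau : source d -> nat -> Omega -> R)
  (S : source d -> nat -> nat -> Omega -> site d)
  (hin : random_inputs P N tau S)
  (n K : nat) (hn : (1 <= n)%N) (hK : (1 <= K)%N) :
  {ae P, forall w,
    let F (M : nat) : graph d :=
      forest (fun z j => tau z j w) (fun z j k => S z j k w) n M in
    exists N0 : nat, forall N1 : nat, (N0 <= N1)%N ->
      restrict_strip K (F N1) = restrict_strip K (F N0)}.
Proof.
case: d hd N tau S hin => // d _ N tau S hin.
have [C [C0 /choice[B /choice[H BH]]]] := step_bound_summable R d n K.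
have steps M := outer_le_mono (let: And3 _ _ h := BH M in h)
  (step_bound hin K hn M (let: And3 h _ _ := BH M in h) (let: And3 _ h _ := BH M in h)).
have sum_le m : \sum_(k < m) C * (k.+1%:R ^+ 2)^-1 <= C * 2.
  by rewrite -mulr_sumr ler_wpM2l ?sum_inv_square_le.
have e_ge0 k : 0 <= C * (k.+1%:R ^+ 2)^-1 by rewrite mulr_ge0 ?invr_ge0 ?exprn_ge0.
apply: filterS (borel_cantelli steps e_ge0 sum_le) => w [k0 k0P] /=.
(* From [k0] on, consecutive forests agree in the strip, so all later ones equal the one at [k0]. *)
exists k0 => N1 /subnKC <-; elim: (N1 - k0)%N => [|j IH]; first by rewrite addn0.
by rewrite addnS -IH; apply: contrapT; apply: k0P; apply: leq_addr.
Qed.
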